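(* Let $k\in(0,1)$ and let $E$ be an ideal semi shift-invariant lattice on $\mathbb{R}_+$, with associated space $E^1$, such that $$(\cdot)^{1-k}\chi_{(0,1)}(\cdot)\in E^1\quad\text{and}\quad\lim_{h\to0^+}\left\|(\cdot)^{1-k}\chi_{(0,h)}(\cdot)\right\|_{E^1}=0.$$ For $h>0$ let $\tau_h(x)=x^{1-k}-h^{-k}x$ for $x\in[0,h)$ and $\tau_h(x)=0$ for $x\geqslant h$. Then for every $f\in L^2_{\infty,E}(\mathbb{R}_+)$ and $h>0$, there holds the sharp inequality $$\left\|D^k_-f\right\|_{L_\infty(\mathbb{R}_+)}\leqslant\frac{2h^{-k}}{\Gamma(2-k)}\,\|f\|_{L_\infty(\mathbb{R}_+)}+\frac{\|\tau_h\|_{E^1}}{\Gamma(2-k)}\,\|f''\|_E.$$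
   Context: $\mathbb{R}_+=[0,+\infty)$; $\chi_B$ is the indicator function of $B$. An ideal lattice on $\mathbb{R}_+$ is a linear space $E$ of measurable functions $\mathbb{R}_+\to\mathbb{R}$ with a norm $\|\cdot\|_E$ such that if $f\in E$, $g$ is measurable and $|g|\leqslant|f|$ a.e., then $g\in E$ and $\|g\|_E\leqslant\|f\|_E$. It is semi shift-invariant if for every $f\in E$ and $x\in\mathbb{R}_+$ we have $f(\cdot+x)\in E$ and $\|f(\cdot+x)\|_E\leqslant\|f\|_E$. The support $A(E)\subset\mathbb{R}_+$ of $E$ is the set such that $f(x)=0$ for every $f\in E$, $x\notin A(E)$. The associated space $E^1$ consists of measurable $g$ with $\mathrm{supp}\,g\subset A(E)$ and $\|g\|_{E^1}:=\sup\{\int_{\mathbb{R}_+}f(x)g(x)\,dx:f\in E,\ \|f\|_E\leqslant1\}<\infty$. $L^2_{\infty,E}(\mathbb{R}_+)$ is the space of $f\in L_\infty(\mathbb{R}_+)$ such that $f'$ is locally absolutely continuous on $\mathbb{R}_+$ and $f''\in E$. Marchaud derivative: for $k>0$, $k\notin\mathbb{N}$, $f:\mathbb{R}_+\to\mathbb{R}$, $x\in\mathbb{R}_+$, $D^k_-f(x)=\frac{1}{\varkappa(k,n)}\int_0^{+\infty}\frac{(\Delta^n_{-t}f)(x)}{t^{1+k}}\,dt$, where $n\in\mathbb{N}$, $n>k$ (the definition does not depend on $n$), $(\Delta^n_{-t}f)(x)=\sum_{m=0}^n(-1)^m\binom{n}{m}f(x+mt)$ and $\varkappa(k,n)=\Gamma(-k)\sum_{m=0}^n(-1)^m\binom{n}{m}m^k$.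 An inequality $\|D^k_-f\|_{L_\infty(\mathbb{R}_+)}\leqslant A\|f\|_{L_\infty(\mathbb{R}_+)}+B\|f''\|_E$ is called sharp here in the sense that for every sufficiently small $\varepsilon>0$ there is $f_\varepsilon\in L^2_{\infty,E}(\mathbb{R}_+)$ with $\|D^k_-f_\varepsilon\|_{L_\infty(\mathbb{R}_+)}>A\|f_\varepsilon\|_{L_\infty(\mathbb{R}_+)}+(B-\varepsilon)\|f_\varepsilon''\|_E$. *)

(* Defs.v *)
From HB Require Import structures.
From mathcomp Require Import all_boot all_order all_algebra.
From mathcomp Require Import all_classical all_reals all_analysis.

Set Implicit Arguments.
Unset Strict Implicit.
Unset Printing Implicit Defensive.

Import Order.TTheory GRing.Theory Num.Theory.
Import numFieldNormedType.Exports.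

Local Open Scope classical_set_scope.
Local Open Scope ring_scope.

(* A function on the half-line is a function R -> R of which only the values on
   Rp matter: measurability, almost-everywhere relations, integrals, norms and
   derivatives below are all relative to Rp. *)
Definition Rp {R : realType} : set R := `[0, +oo[.

(* Functions are taken modulo equality a.e. on Rp, and measurable means Borel
   measurable; every Lebesgue measurable function is a.e. equal to such a one.
   [lat_eq0] is definiteness of the norm on classes; invariance of membership
   and of the norm under a.e. equality follow from [lat_ideal]. *)
Record idealLattice (R : realType) := IdealLattice {
  lat_set : set (R -> R);
  lat_norm : (R -> R) -> R;
  lat_measurable : forall f : R -> R, lat_set f -> measurable_fun Rp f;
  lat0 : lat_set (fun=> 0);
  latD : forall f g : R -> R, lat_set f -> lat_set g ->
    lat_set (fun x => f x + g x);
  latZ : forall (a : R) (f : R -> R), lat_set f -> lat_set (fun x => a * f x);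
  lat_normD : forall f g : R -> R, lat_set f -> lat_set g ->
    lat_norm (fun x => f x + g x) <= lat_norm f + lat_norm g;
  lat_normZ : forall (a : R) (f : R -> R), lat_set f ->
    lat_norm (fun x => a * f x) = `|a| * lat_norm f;
  lat_eq0 : forall f : R -> R, lat_set f -> lat_norm f = 0 ->
    f = (fun=> 0) %[ae lebesgue_measure in Rp];
  lat_ideal : forall f g : R -> R, lat_set f -> measurable_fun Rp g ->
    {ae lebesgue_measure, forall x : R, Rp x -> `|g x| <= `|f x|} ->
    lat_set g /\ lat_norm g <= lat_norm f }.

Definition semi_shift_invariant (R : realType) (E : idealLattice R) : Prop :=
  forall (f : R -> R) (x : R), lat_set E f -> Rp x ->
    lat_set E (fun t => f (t + x)) /\
    lat_norm E (fun t => f (t + x)) <= lat_norm E f.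

Definition vanishes_off (R : realType) (A : set R) (f : R -> R) : Prop :=
  f = (fun=> 0) %[ae lebesgue_measure in Rp `\` A].

(* The support of E is determined up to a null set: it is the smallest, modulo
   null sets, measurable set off which every f in E vanishes a.e.  (A pointwise
   reading would always give Rp, as E contains all functions that are 0 a.e.) *)
Definition is_support (R : realType) (E : idealLattice R) (A : set R) : Prop :=
  [/\ measurable A, A `<=` Rp,
      forall f, lat_set E f -> vanishes_off A f
    & forall B, measurable B -> (forall f, lat_set E f -> vanishes_off B f) ->
        lebesgue_measure.-negligible (A `\` B)].

(* In \bar R, +oo - +oo = -oo, so an f for which the integral is undefined does
   not contribute to the supremum. *)
Definition assoc_norm (R : realType) (E : idealLattice R) (g : R -> R) :
    \bar R :=
  ereal_sup [set (\int[lebesgue_measure]_(x in Rp) (f x * g x)%:E)%E |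
             f in [set f | lat_set E f /\ lat_norm E f <= 1]].

Definition assoc_space (R : realType) (E : idealLattice R) : set (R -> R) :=
  [set g | [/\ measurable_fun Rp g,
               exists2 A, is_support E A & vanishes_off A g
             & (assoc_norm E g < +oo)%E]].

Definition Linf_norm (R : realType) (f : R -> \bar R) : \bar R :=
  'N[@lebesgue_measure R]_+oo[f \_ Rp]%E.

Definition Linf (R : realType) : set (R -> R) :=
  [set f | measurable_fun Rp f /\ (Linf_norm (EFin \o f) < +oo)%E].

(* Derivative of a function on the half-line: two-sided at x > 0, right
   derivative at x = 0. *)
Definition has_deriv (R : realType) (f : R -> R) (x l : R) : Prop :=
  (f (x + h) - f x) / h @[h --> within [set h | Rp (x + h)] (0 : R)^'] --> l.

Definition abs_continuous (R : realType) (a b : R) (f : R -> R) : Prop :=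
  forall e : R, 0 < e -> exists2 d : R, 0 < d &
    forall (n : nat) (u v : 'I_n -> R),
      (forall i, [/\ a <= u i, u i <= v i & v i <= b]) ->
      trivIset setT (fun i => `]u i, v i[%classic : set R) ->
      \sum_(i < n) (v i - u i) < d ->
      \sum_(i < n) `|f (v i) - f (u i)| < e.

Definition loc_abs_continuous (R : realType) (f : R -> R) : Prop :=
  forall a b : R, Rp a -> abs_continuous a b f.

(* f'' only exists a.e.; f2 is any version of it. *)
Definition second_derivative (R : realType) (f f2 : R -> R) : Prop :=
  exists f1 : R -> R,
    [/\ forall x, Rp x -> has_deriv f x (f1 x),
        loc_abs_continuous f1
      & {ae lebesgue_measure, forall x : R, Rp x -> has_deriv f1 x (f2 x)}].

(* f belongs to L^2_{oo,E}(Rp), and f2 in E is a version of f''; the norm of f2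
   in E does not depend on the version. *)
Definition L2infE (R : realType) (E : idealLattice R) (f f2 : R -> R) : Prop :=
  [/\ Linf f, second_derivative f f2 & lat_set E f2].

Definition Euler_integral (R : realType) (x : R) : R :=
  \int[lebesgue_measure]_(t in `]0, +oo[) (t `^ (x - 1) * expR (- t)).

(* Euler's integral for x > 0, extended to the other non-poles by
   Gamma x = Gamma (x + m) / (x (x + 1) ... (x + m - 1)), with x + m > 0. *)
Definition Gamma (R : realType) (x : R) : R :=
  let m := if 0 < x then 0%N else (Num.truncn (- x)).+1 in
  Euler_integral (x + m%:R) / \prod_(i < m) (x + i%:R).

Definition finite_diff (R : realType) (n : nat) (f : R -> R) (x t : R) : R :=
  \sum_(m < n.+1) (-1) ^+ m * 'C(n, m)%:R * f (x + m%:R * t).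

(* powR satisfies 0 `^ k = 0 for k != 0, as needed for the term m = 0. *)
Definition varkappa (R : realType) (k : R) (n : nat) : R :=
  Gamma (- k) * \sum_(m < n.+1) (-1) ^+ m * 'C(n, m)%:R * (m%:R `^ k).

(* Valued in \bar R: if the positive and negative parts of the integrand both
   have infinite integral, the result is infinite, so a finite value entails
   absolute convergence. *)
Definition Marchaud (R : realType) (k : R) (n : nat) (f : R -> R) (x : R) :
    \bar R :=
  (((varkappa k n)^-1)%:E *
   \int[lebesgue_measure]_(t in `]0%R, +oo[)
     (finite_diff n f x t / t `^ (1 + k))%:E)%E.

Definition tau (R : realType) (k h x : R) : R :=
  if x < h then x `^ (1 - k) - h `^ (- k) * x else 0.

(* Main.v *)
Require Import Defs.
From HB Require Import structures.
From mathcomp Require Import all_boot all_order all_algebra.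
From mathcomp Require Import all_classical all_reals all_analysis.
From mathcomp Require Import measurable_realfun ess_sup_inf ring lra.

Set Implicit Arguments.
Unset Strict Implicit.
Unset Printing Implicit Defensive.

Import Order.TTheory GRing.Theory Num.Theory.
Import numFieldNormedType.Exports.

Local Open Scope classical_set_scope.
Local Open Scope ring_scope.

(* Put n = 1.  Everything rests on the formula
     k (1 - k) \int_0^oo min(u, t) / t^(1 + k) dt = u^(1 - k)        (u >= 0).
   Upper bound: for the kernel K(t, s) = min(s, t) - min(h, t) s / h, which on
   t <= h is the Green function of - d^2/ds^2, and M = ||f||_oo,
     |f(x) - f(x + t)| <= 2 M min(h, t) / h + \int_0^h K(t, s) |f''(x + s)| ds
   for all t > 0.  Multiplying by k (1 - k) / t^(1 + k) and integrating, the
   formula turns min(h, t) / h into h^(- k) and K(t, s) into tau_h(s), and the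
   last integral is at most ||tau_h||_{E^1} ||f''||_E.
   Sharpness: take a bounded g >= 0 in the unit ball of E, supported in [0, h],
   with \int tau_h g close to ||tau_h||_{E^1}, and f with f'' = g, f constant
   after h and f(0) = - f(h) = ||f||_oo.  Then f(x) - f(x + t) is the integral
   of min((s - x)^+, t) g(s) ds, so the formula gives
     Gamma(2 - k) D^k f(x) = \int_0^h ((s - x)^+)^(1 - k) g(s) ds,
   which tends to 2 h^(- k) ||f||_oo + \int tau_h g as x -> 0.
   For general n, the integral defining D^k f is the one for n = 1 times
   - \sum_m (- 1)^m C(n, m) m^k, which is nonzero: test it on exp (- t). *)

(** * Tonelli's theorem and affine changes of variables *)

(** No integrability of f'' is assumed, so the upper bound is a chain of inequalities between
    nonnegative extended reals, interchanging integrals by Tonelli. Absolute convergence of the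
    integral defining D^k f is a consequence of the finite bound, and only then is the normalisation
    of D^k simplified. Everything is estimated at the point 0, for the translate f(. + x); semi
    shift-invariance bounds the norm of f''(. + x) by that of f''. Two facts about ||tau_h||_{E^1}
    are needed. It is finite for every h, although the hypothesis concerns only (0, 1): shifts carry
    the estimate to longer intervals. It is positive, so that there are errors e > 0 for which the
    coefficient of ||f''||_E in the sharpness claim stays nonnegative; only then may ||g||_E <= 1 be
    used. An L_oo norm does not see the value at 0, so the limit x -> 0 is made quantitative: the
    lower bound for D^k f loses x^(1 - k) \int g, which is small on a whole interval (0, d). *)

Section tonelli_affine.
Context {R : realType}.
Local Notation mu := (@lebesgue_measure R).
Local Open Scope ereal_scope.

(** Extend K by 0 off [D1]*[D2] and apply Tonelli's theorem on the plane. *)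
Lemma ge0_tonelli_in (D1 D2 : set R) (K : R -> R -> \bar R) :
  measurable D1 -> measurable D2 ->
  measurable_fun (D1 `*` D2) (fun z : R * R => K z.1 z.2) ->
  (forall x y, D1 x -> D2 y -> 0 <= K x y) ->
  \int[mu]_(x in D1) \int[mu]_(y in D2) K x y =
  \int[mu]_(y in D2) \int[mu]_(x in D1) K x y.
Proof.
move=> mD1 mD2 mK K0.
pose G := (fun z : R * R => K z.1 z.2) \_ (D1 `*` D2).
have mG : measurable_fun setT G.
  by apply/(measurable_restrictT _ _).1 => //; exact: measurableX.
have G0 z : 0 <= G z.
  by rewrite /G; apply: erestrict_ge0 => -[x y] [/= xD yD]; exact: K0.
have Gin x y : D1 x -> D2 y -> G (x, y) = K x y.
  by move=> xD yD; rewrite /G patchE mem_set.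
have Gn1 x y : ~ D1 x -> G (x, y) = 0.
  by move=> xD; rewrite /G patchE memNset// => -[].
have Gn2 x y : ~ D2 y -> G (x, y) = 0.
  by move=> xD; rewrite /G patchE memNset// => -[].
have := @fubini_tonelli _ _ (measurableTypeR R) (measurableTypeR R) R mu mu G mG G0.
move=> e.
transitivity (\int[mu]_x \int[mu]_y G (x, y)); last rewrite e.
- rewrite integral_mkcond; apply: eq_integral => x _; rewrite patchE.
  case: ifPn => [/set_mem xD|xD].
    rewrite integral_mkcond; apply: eq_integral => y _; rewrite patchE.
    case: ifPn => [/set_mem yD|/negP yD]; first by rewrite Gin.
    by apply/esym/Gn2 => ?; apply: yD; rewrite inE.
  apply/esym/integral0_eq => y _; apply: Gn1 => ?; by move/negP: xD; rewrite inE.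
- rewrite [RHS]integral_mkcond; apply: eq_integral => y _; rewrite patchE.
  case: ifPn => [/set_mem xD|xD].
    rewrite [RHS]integral_mkcond; apply: eq_integral => x _; rewrite patchE.
    by case: ifPn => [/set_mem yD|/negP yD]; [rewrite Gin|apply/Gn1 => ?; apply: yD; rewrite inE].
  apply: integral0_eq => x _; apply: Gn2 => ?; by move/negP: xD; rewrite inE.
Qed.

Lemma measurable_fun_le_indicator (D : set (R * R)) :
  measurable_fun D (fun z : R * R => if (z.1 <= z.2)%R then 1%R else 0%R : R).
Proof.
apply: measurable_funTS; apply: measurable_fun_ifT => //.
by apply: measurable_fun_ler; [exact: measurable_fst|exact: measurable_snd].
Qed.

Lemma measurable_fun_ge_indicator (D : set (R * R)) :
  measurable_fun D (fun z : R * R => if (z.2 <= z.1)%R then 1%R else 0%R : R).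
Proof.
apply: measurable_funTS; apply: measurable_fun_ifT => //.
by apply: measurable_fun_ler; [exact: measurable_snd|exact: measurable_fst].
Qed.

Lemma measurable_fun_snd (D1 D2 : set R) (f : R -> R) : measurable D1 ->
  measurable D2 -> measurable_fun D2 f ->
  measurable_fun (D1 `*` D2) (fun z : R * R => f z.2).
Proof.
move=> mD1 mD2 mf; apply: (measurable_comp mD2 _ mf) => //.
  by move=> _ [[x y] [_ /= Dy] <-].
by apply: measurable_funTS; exact: measurable_snd.
Qed.

Lemma measurable_fun_fst (D1 D2 : set R) (f : R -> R) : measurable D1 ->
  measurable D2 -> measurable_fun D1 f ->
  measurable_fun (D1 `*` D2) (fun z : R * R => f z.1).
Proof.
move=> mD1 mD2 mf; apply: (measurable_comp mD1 _ mf) => //.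
  by move=> _ [[x y] [/= Dx _] <-].
by apply: measurable_funTS; exact: measurable_fst.
Qed.

(** The two extensions by 0 coincide. This trades an indicator inside a kernel for a smaller domain
    of integration, and conversely. *)
Lemma eq_integral_support (D1 D2 : set R) (f g : R -> \bar R) :
  (forall x, D1 x -> D2 x -> f x = g x) ->
  (forall x, D1 x -> ~ D2 x -> f x = 0) ->
  (forall x, D2 x -> ~ D1 x -> g x = 0) ->
  \int[mu]_(x in D1) f x = \int[mu]_(x in D2) g x.
Proof.
move=> fg f0 g0; rewrite [LHS]integral_mkcond [RHS]integral_mkcond.
apply: eq_integral => x _; rewrite !patchE.
case: ifPn => [/set_mem|/negP] x1; case: ifPn => [/set_mem|/negP] x2.
- exact: fg.
- by apply: f0 => // ?; apply: x2; rewrite inE.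
- by apply/esym/g0 => // ?; apply: x1; rewrite inE.
- by [].
Qed.

Lemma measurable_integral_section (D1 D2 : set R) (K : R -> R -> \bar R) :
  measurable D1 -> measurable D2 ->
  measurable_fun (D1 `*` D2) (fun z : R * R => K z.1 z.2) ->
  (forall x y, D1 x -> D2 y -> 0 <= K x y) ->
  measurable_fun D1 (fun x => \int[mu]_(y in D2) K x y).
Proof.
move=> mD1 mD2 mK K0.
pose G := (fun z : R * R => K z.1 z.2) \_ (D1 `*` D2).
have mG : measurable_fun setT G.
  by apply/(measurable_restrictT _ _).1 => //; exact: measurableX.
have G0 z : 0 <= G z.
  by rewrite /G; apply: erestrict_ge0 => -[x y] [/= xD yD]; exact: K0.
have := @measurable_fun_fubini_tonelli_F _ _ (measurableTypeR R) (measurableTypeR R) R mu G mG G0.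
move=> /(measurable_funS measurableT (@subsetT _ D1)).
apply: eq_measurable_fun => x /set_mem xD.
apply: eq_integral_support => y //= _.
- by move=> yD; rewrite /G patchE mem_set.
- by move=> yD; rewrite /G patchE memNset// => -[].
Qed.

Lemma ge0_integralZl_real (D : set R) (f : R -> R) (c : R) :
  measurable D -> measurable_fun D f -> (forall x, D x -> (0 <= f x)%R) ->
  (0 <= c)%R ->
  \int[mu]_(x in D) (c * f x)%:E = c%:E * \int[mu]_(x in D) (f x)%:E.
Proof.
move=> mD mf f0 c0; rewrite -ge0_integralZl_EFin//.
exact/measurable_EFinP.
Qed.

Lemma measurable_affine (m c : R) :
  measurable_fun setT
    ((fun x : R => m * x + c)%R : measurableTypeR R -> measurableTypeR R).
Proof. by apply: measurable_funD => //; apply: measurable_funM. Qed.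

(** As a function of A, the right-hand side is m times the push-forward of [mu] under x -> m x + c;
    by uniqueness of Lebesgue measure it suffices to compare both sides on half-open intervals. *)
Lemma lebesgue_measure_affine (m c : R) (A : set R) : (0 < m)%R ->
  measurable A ->
  mu A = m%:E * mu [set x | A (m * x + c)%R].
Proof.
move=> m0 mA.
pose phi : measurableTypeR R -> measurableTypeR R := fun x => (m * x + c)%R.
have mphi : measurable_fun setT phi by exact: measurable_affine.
rewrite (_ : _ * _ = mscale (NngNum (ltW m0)) (pushforward mu phi) A) //.
apply: lebesgue_measure_unique mA => // _ [[a b]] _ <-.
transitivity (m%:E * mu (phi @^-1` `]a, b]%classic)); last by [].
rewrite (_ : _ @^-1` _ = `](a - c) / m, (b - c) / m]%classic)%R; last first.
  apply/seteqP; split => x /=;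
    by rewrite !in_itv/= /phi ltr_pdivrMr// ler_pdivlMr// ltrBlDr lerBrDr mulrC.
rewrite !lebesgue_measure_itv/= !lte_fin ltr_pM2r ?invr_gt0// ltrD2r.
case: ifP => _; last by rewrite mule0.
rewrite -!EFinB -EFinM; congr EFin; field; exact: lt0r_neq0.
Qed.

Lemma ge0_integral_affine (m c : R) (D : set R) (f : R -> \bar R) :
  (0 < m)%R -> measurable D -> measurable_fun D f ->
  (forall x, D x -> 0 <= f x) ->
  \int[mu]_(y in D) f y =
  m%:E * \int[mu]_(x in [set x | D (m * x + c)%R]) f (m * x + c)%R.
Proof.
move=> m0 mD mf f0.
pose phi : measurableTypeR R -> measurableTypeR R := fun x => (m * x + c)%R.
have mphi : measurable_fun setT phi by exact: measurable_affine.
pose nu := measure_function_pushforward__canonical__measure_function_Measure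
  mu mphi.
transitivity (\int[mscale (NngNum (ltW m0)) nu]_(y in D) f y).
  by apply: eq_measure_integral => A mA _; exact: lebesgue_measure_affine.
rewrite ge0_integral_mscale//=; congr (_ * _).
by rewrite (@ge0_integral_pushforward _ _ _ _ _ phi mphi)// => y /set_mem; exact: f0.
Qed.

Lemma negligible_affine (m c : R) (A : set R) : (0 < m)%R ->
  mu.-negligible A -> mu.-negligible [set x | A (m * x + c)%R].
Proof.
move=> m0 [N [mN N0 AN]]; exists [set x | N (m * x + c)%R]; split.
- by rewrite -[X in measurable X]setTI; exact: (measurable_affine m c).
- have := lebesgue_measure_affine c m0 mN; rewrite N0 => /esym/eqP.
  by rewrite mule_eq0 eqe gt_eqF//= => /eqP.
- by move=> x /=; exact: AN.
Qed.

End tonelli_affine.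

(** * Power integrals and the Gamma function *)

Section power_integrals.
Context {R : realType}.
Local Notation mu := (@lebesgue_measure R).
Implicit Types (p u k : R).

Lemma continuous_powR (p x : R) : 0 < x -> {for x, continuous (@powR R ^~ p)}.
Proof.
move=> x0; apply: differentiable_continuous; apply/derivable1_diffP.
by apply: derivable_powR; rewrite in_itv/= x0.
Qed.

Lemma within_continuous_powR p (a : R) (b : itv_bound R) : 0 < a ->
  {within [set` Interval (BLeft a) b], continuous (@powR R ^~ p)}.
Proof.
move=> a0; apply: continuous_in_subspaceT => x; rewrite inE/= itv_boundlr => /andP[/= ax _].
by apply: continuous_powR; apply: lt_le_trans a0 _; rewrite bnd_simp in ax.
Qed.

Lemma powR_divp_derive (p x : R) : p != 0 -> 0 < x ->
  is_derive x 1 (fun t : R => t `^ p / p) (x `^ (p - 1)).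
Proof.
move=> p0 x0.
have := @is_deriveZ R R _ (@powR R ^~ p) p^-1 x 1 _ (is_derive1_powR p x0).
have -> : p^-1 \*: (@powR R ^~ p) = (fun t : R => t `^ p / p).
  by apply/funext => t; rewrite mulrC.
by move=> /= h; apply: is_derive_eq h _; rewrite /GRing.scale/= mulrA mulVf// mul1r.
Qed.

Lemma integral_powR_itv (p a b : R) : p != 0 -> 0 < a -> a <= b ->
  (\int[mu]_(t in `[a, b]) (t `^ (p - 1))%:E = (b `^ p / p - a `^ p / p)%:E)%E.
Proof.
move=> p0 a0; rewrite le_eqVlt => /predU1P[->|ab].
  by rewrite set_itv1 integral_set1 subrr.
rewrite (@continuous_FTC2 _ (@powR R ^~ (p - 1)) (fun t => t `^ p / p)) ?EFinB//.
- exact: within_continuous_powR.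
- have cF x : 0 < x -> {for x, continuous (fun t : R => t `^ p / p)}.
    by move=> x0; apply: cvgMl; exact: continuous_powR.
  split.
  + move=> x; rewrite in_itv/= => /andP[ax _].
    by have [] := powR_divp_derive p0 (lt_trans a0 ax).
  + by apply: cvg_at_right_filter; exact: cF.
  + by apply: cvg_at_left_filter; apply: cF; exact: lt_trans ab.
- move=> x; rewrite in_itv/= => /andP[ax _].
  by have [_] := powR_divp_derive p0 (lt_trans a0 ax); rewrite derive1E.
Qed.

Lemma cvg_powR_harmonic (p : R) : 0 < p ->
  (n.+1%:R^-1 `^ p : R) @[n --> \oo] --> (0 : R).
Proof.
move=> p0; have /cvg_at_rightP := @powR_cvg0 R p p0.
by apply; split; [move=> n; rewrite invr_gt0 | exact: cvg_harmonic].
Qed.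

Lemma measurable_powR_in (D : set R) (p : R) :
  measurable_fun D (fun t : R => t `^ p).
Proof. by apply: measurable_funTS; exact: measurable_powR. Qed.

Lemma measurable_div_powR (D : set R) (f : R -> R) (p : R) :
  measurable_fun D f -> measurable_fun D (fun t : R => f t / t `^ p).
Proof.
move=> mf; under eq_fun do rewrite -powRN.
by apply: measurable_funM => //; exact: measurable_powR_in.
Qed.

(** Monotone convergence along [u / (n + 1), u]. With endpoints proportional to u, the boundary term
    is (n + 1)^(- p) times the final answer, hence tends to 0. *)
Lemma integral_powR_0 (p u : R) : 0 < p -> 0 < u ->
  (\int[mu]_(t in `]0%R, u]) (t `^ (p - 1))%:E = (u `^ p / p)%:E)%E.
Proof.
move=> p0 u0.
pose F n := `[n.+1%:R^-1 * u, u]%classic : set R.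
have F0 n : 0 < n.+1%:R^-1 * u by rewrite mulr_gt0// invr_gt0.
have -> : `]0, u]%classic = \bigcup_n F n.
  apply/seteqP; split => [x /=|x [n _]]; rewrite /F/= !in_itv/=.
  - move=> /andP[x0 xu].
    have [n] := ltr_add_invr (divr_gt0 x0 u0); rewrite add0r => nx.
    by exists n => //=; rewrite in_itv/= xu -ler_pdivlMr// ltW.
  - by move=> /andP[+ ->]; rewrite andbT; exact: lt_le_trans.
have h1 : (\int[mu]_(t in F i) (t `^ (p - 1))%:E)%E @[i --> \oo] -->
   (\int[mu]_(t in \bigcup_n F n) (t `^ (p - 1))%:E)%E.
  apply: ge0_nondecreasing_set_cvg_integral.
  - apply/nondecreasing_seqP => n; apply/subsetPset => x; rewrite /F/= !in_itv/=.
    move=> /andP[+ ->]; rewrite andbT; apply: le_trans.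
    by rewrite ler_pM2r// lef_pV2 ?posrE// ler_nat.
  - by move=> n; exact: measurable_itv.
  - by move=> n; apply/measurable_EFinP; exact: measurable_powR_in.
  - by move=> n x _; rewrite lee_fin powR_ge0.
have h2 : (\int[mu]_(t in F i) (t `^ (p - 1))%:E)%E @[i --> \oo] -->
   (u `^ p / p)%:E.
  have e n : (\int[mu]_(t in F n) (t `^ (p - 1))%:E)%E =
      (u `^ p / p - n.+1%:R^-1 `^ p * (u `^ p / p))%:E.
    rewrite /F integral_powR_itv ?gt_eqF//.
      by rewrite powRM ?invr_ge0 ?ltW// mulrA.
    by rewrite ger_pMl// invf_le1// ler1n.
  under eq_fun do rewrite e.
  apply: cvg_EFin; first by apply: nearW.
  rewrite /comp/= -[X in _ --> X]subr0.
  apply: cvgB; first exact: cvg_cst.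
  rewrite -(mul0r (u `^ p / p)).
  by apply: cvgMl; exact: cvg_powR_harmonic.
exact: cvg_unique h1 h2.
Qed.

(** Monotone convergence along [u, (n + 1) u], with the same boundary term as on the side of 0. *)
Lemma integral_powR_y (p u : R) : 0 < p -> 0 < u ->
  (\int[mu]_(t in `[u, +oo[) (t `^ (- p - 1))%:E = (u `^ (- p) / p)%:E)%E.
Proof.
move=> p0 u0.
pose F n := `[u, n.+1%:R * u]%classic : set R.
have -> : `[u, +oo[%classic = \bigcup_n F n.
  apply/seteqP; split => [x /=|x [n _]]; rewrite /F/= !in_itv/= ?andbT.
  - move=> ux; exists (Num.truncn (x / u)) => //=; rewrite in_itv/= ux.
    by rewrite -ler_pdivrMr// ltW// truncnS_gt.
  - by move=> /andP[+ _].
have h1 : (\int[mu]_(t in F i) (t `^ (- p - 1))%:E)%E @[i --> \oo] -->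
   (\int[mu]_(t in \bigcup_n F n) (t `^ (- p - 1))%:E)%E.
  apply: ge0_nondecreasing_set_cvg_integral.
  - apply/nondecreasing_seqP => n; apply/subsetPset => x; rewrite /F/= !in_itv/=.
    move=> /andP[->] /=; move=> /le_trans; apply.
    by rewrite ler_pM2r// ler_nat.
  - by move=> n; exact: measurable_itv.
  - by move=> n; apply/measurable_EFinP; exact: measurable_powR_in.
  - by move=> n x _; rewrite lee_fin powR_ge0.
have h2 : (\int[mu]_(t in F i) (t `^ (- p - 1))%:E)%E @[i --> \oo] -->
   (u `^ (- p) / p)%:E.
  have e n : (\int[mu]_(t in F n) (t `^ (- p - 1))%:E)%E =
      (u `^ (- p) / p - n.+1%:R^-1 `^ p * (u `^ (- p) / p))%:E.
    rewrite /F integral_powR_itv ?oppr_eq0 ?gt_eqF//.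
      rewrite powRM ?ltW// -[X in n.+1%:R `^ (- X)]mul1r -mulNr powRrM.
      by rewrite powR_inv1// invrN !mulrN opprK addrC mulrA.
    by rewrite ler_pMl// ler1n.
  under eq_fun do rewrite e.
  apply: cvg_EFin; first by apply: nearW.
  rewrite /comp/= -[X in _ --> X]subr0.
  apply: cvgB; first exact: cvg_cst.
  rewrite -(mul0r (u `^ (- p) / p)).
  by apply: cvgMl; exact: cvg_powR_harmonic.
exact: cvg_unique h1 h2.
Qed.

End power_integrals.

(** * The integral of min(u, t) / t^(1 + k), and the values of Gamma at - k and 2 - k *)

Section min_kernel_and_Gamma.
Context {R : realType}.
Local Notation mu := (@lebesgue_measure R).

(** Split at t = u: the two pieces are u^(1 - k) / (1 - k) and u u^(- k) / k. *)
Lemma integral_min_powR (k u : R) : 0 < k -> k < 1 -> 0 <= u ->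
  (\int[mu]_(t in `]0%R, +oo[) (Num.min u t / t `^ (1 + k))%:E =
   (u `^ (1 - k) / (k * (1 - k)))%:E)%E.
Proof.
move=> k0 k1; rewrite le_eqVlt => /predU1P[<-|u0].
  rewrite powR0 ?mul0r; last by rewrite subr_eq0 gt_eqF.
  apply: integral0_eq => t /=; rewrite in_itv/= andbT => t0.
  by rewrite min_l ?mul0r// ltW.
have kn0 : k != 0 by rewrite gt_eqF.
have k1n0 : 1 - k != 0 by rewrite subr_eq0 gt_eqF.
rewrite (_ : `]0, +oo[%classic = `]0, u] `|` `]u, +oo[); last first.
  by rewrite -itv_bndbnd_setU//; rewrite bnd_simp ltW.
rewrite ge0_integral_setU//=; last 3 first.
- apply/measurable_EFinP; apply: measurable_div_powR.
  exact: measurable_minr.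
- move=> x xx; rewrite lee_fin divr_ge0 ?powR_ge0// le_min (ltW u0)/=.
  by case: xx => /=; rewrite in_itv/= => /andP[]; [move=> /ltW|move=> /(lt_trans u0)/ltW].
- rewrite disj_set2E; apply/eqP; rewrite -subset0 => x [] /=; rewrite !in_itv/=.
  by move=> /andP[_ xu] /andP[]; rewrite ltNge xu.
have -> : (\int[mu]_(x in `]0%R, u]) (Num.min u x / x `^ (1 + k))%:E =
  \int[mu]_(x in `]0%R, u]) (x `^ ((1 - k) - 1))%:E)%E.
  apply: eq_integral => x; rewrite inE/= in_itv/= => /andP[x0 xu].
  rewrite min_r//; congr EFin.
  rewrite -[X in X / _ = _]powRr1 ?ltW// -powRB ?(gt_eqF x0) ?implybT//.
  by congr powR; ring.
rewrite integral_powR_0 ?subr_gt0//.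
have -> : (\int[mu]_(x in `]u, +oo[) (Num.min u x / x `^ (1 + k))%:E =
  u%:E * \int[mu]_(x in `[u, +oo[) (x `^ (- k - 1))%:E)%E.
  rewrite -ge0_integralZl_EFin//=; last 3 first.
  - by move=> x _; rewrite lee_fin powR_ge0.
  - by apply/measurable_EFinP; exact: measurable_powR_in.
  - exact: ltW.
  rewrite -integral_itv_obnd_cbnd; last first.
    apply/measurable_EFinP; apply: measurable_funM => //.
    exact: measurable_powR_in.
  apply: eq_integral => x; rewrite inE/= in_itv/= andbT => ux.
  rewrite min_l ?ltW//; congr EFin; congr (_ * _).
  by rewrite -powRN; congr powR; ring.
rewrite integral_powR_y// -EFinM -EFinD; congr EFin.
have -> : u `^ (- k) = u `^ (1 - k) / u.
  rewrite -[X in _ = _ / X]powRr1 ?ltW// -powRB ?(gt_eqF u0) ?implybT//.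
  by congr powR; ring.
by field; rewrite kn0 k1n0 gt_eqF.
Qed.

Lemma integral_expRN (s : R) :
  (\int[mu]_(t in `[s, +oo[) (expR (- t))%:E = (expR (- s))%:E)%E.
Proof.
rewrite (@ge0_continuous_FTC2y _ (fun t => expR (- t)) (fun t => - expR (- t)) s 0).
- by rewrite sub0e EFinN oppeK.
- by move=> *; exact: expR_ge0.
- apply: continuous_subspaceT => x; apply: continuous_comp.
    exact: opp_continuous.
  exact: continuous_expR.
- rewrite -oppr0; apply: cvgN; exact: cvgr_expR.
- move=> x _; exact: ex_derive.
- apply: cvgN; apply: cvg_at_right_filter; apply: continuous_comp.
    exact: opp_continuous.
  exact: continuous_expR.
- move=> x _; rewrite derive1E derive_val /=.
  by rewrite /GRing.scale/=; ring.
Qed.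

Lemma measurable_fun_lt_indicator (D : set (R * R)) :
  measurable_fun D (fun z : R * R => if z.1 < z.2 then 1 else 0 : R).
Proof.
apply: measurable_funTS; apply: measurable_fun_ifT => //.
by apply: measurable_fun_ltr; [exact: measurable_fst|exact: measurable_snd].
Qed.

(** A nonnegative function with zero integral vanishes a.e., whereas f vanishes nowhere on D, a set
    of positive measure. *)
Lemma integral_gt0 (D : set R) (f : R -> R) : measurable D -> (0 < mu D)%E ->
  measurable_fun D f -> (forall x, D x -> 0 < f x) ->
  (0 < \int[mu]_(x in D) (f x)%:E)%E.
Proof.
move=> mD D0 mf f0.
rewrite lt0e integral_ge0 ?andbT; last by move=> x Dx; rewrite lee_fin ltW// f0.
apply/eqP => I0.
have mEf : measurable_fun D (EFin \o f) by exact/measurable_EFinP.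
have : (\int[mu]_(x in D) `|(EFin \o f) x| = 0)%E.
  by rewrite -I0; apply: eq_integral => x /set_mem Dx; rewrite /= gtr0_norm ?f0.
move=> /(ae_eq_integral_abs mu mD mEf) [N [mN N0 DN]].
have : (mu D <= mu N)%E.
  apply: le_measure; rewrite ?inE// => x Dx; apply: DN => /= /(_ Dx) [e].
  by have := f0 x Dx; rewrite e ltxx.
by rewrite N0 leNgt D0.
Qed.

(** The integrand of Gamma (p + 1). *)
Definition Euler_density (p t : R) := t `^ p * expR (- t).

Lemma measurable_Euler_density D p : measurable_fun D (Euler_density p).
Proof.
apply: measurable_funM; first exact: measurable_powR_in.
by apply: measurable_funTS; apply: measurableT_comp => //; exact: measurable_expR.
Qed.

Lemma Euler_density_ge0 p t : 0 <= Euler_density p t.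
Proof. by rewrite mulr_ge0 ?powR_ge0 ?expR_ge0. Qed.

(** Instead of integrating by parts, write t^p as the integral of p s^(p - 1) over s < t and
    interchange: the inner integral of exp (- t) over t > s is exp (- s). All terms are nonnegative,
    so finiteness need not be known. *)
Lemma integral_Euler_density_rec (p : R) : 0 < p ->
  (\int[mu]_(t in `]0%R, +oo[) (Euler_density p t)%:E =
   p%:E * \int[mu]_(t in `]0%R, +oo[) (Euler_density (p - 1) t)%:E)%E.
Proof.
move=> p0.
pose K (s t : R) := (if s < t then 1 else 0) * (p * s `^ (p - 1) * expR (- t)).
have KE s t : K s t = (if s < t then 1 else 0) * (p * s `^ (p - 1) * expR (- t)) by [].
have K0 s t : 0 <= K s t.
  by rewrite !mulr_ge0 ?powR_ge0 ?expR_ge0 ?(ltW p0)//; case: ifP.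
pose D : set R := `]0%R, +oo[%classic.
have mK : measurable_fun (D `*` D) (fun z : R * R => (K z.1 z.2)%:E).
  apply/measurable_EFinP; apply: measurable_funM.
    exact: measurable_fun_lt_indicator.
  apply: measurable_funTS; apply: measurable_funM.
    apply: measurable_funM => //.
    exact: (measurableT_comp (measurable_powR (p - 1)) measurable_fst).
  apply: (measurableT_comp (@measurable_expR R)).
  by apply: measurableT_comp => //; exact: measurable_snd.
have mD : measurable D by exact: measurable_itv.
have e := @ge0_tonelli_in R D D (fun x y => (K x y)%:E) mD mD mK (fun x y _ _ => K0 x y).
transitivity (\int[mu]_(y in `]0%R, +oo[) \int[mu]_(x in `]0%R, +oo[) (K x y)%:E)%E.
  apply: eq_integral => t; rewrite inE/= in_itv/= andbT => t0.
  transitivity (\int[mu]_(s in `]0%R, t[) (p * expR (- t) * s `^ (p - 1))%:E)%E.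
    rewrite ge0_integralZl_real; last 4 first.
    - exact: measurable_itv.
    - exact: measurable_powR_in.
    - by move=> x _; rewrite powR_ge0.
    - by rewrite mulr_ge0 ?expR_ge0 ?ltW.
    rewrite integral_itv_bndo_bndc; last first.
      by apply/measurable_EFinP; exact: measurable_powR_in.
    rewrite (integral_powR_0 p0 t0).
    rewrite -EFinM /Euler_density; by congr EFin; field; rewrite gt_eqF.
  apply: eq_integral_support => s; rewrite /D /= !in_itv/= andbT.
  - by move=> /andP[_ st] _; rewrite KE st mul1r mulrAC.
  - by move=> /andP[-> _] /(_ isT) [].
  - by move=> ->; rewrite KE; case: ifP => [_ /(_ isT) []|_ _]; rewrite mul0r.
rewrite -e -ge0_integralZl_real; last 4 first.
- exact: mD.
- exact: measurable_Euler_density.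
- by move=> x _; exact: Euler_density_ge0.
- exact: ltW.
apply: eq_integral => s; rewrite inE /D /= in_itv/= andbT => s0.
transitivity (\int[mu]_(t in `]s, +oo[) (p * s `^ (p - 1) * expR (- t))%:E)%E.
  apply: eq_integral_support => t; rewrite /D /= !in_itv/= !andbT.
  - by move=> _ st; rewrite KE st mul1r.
  - by move=> _ /negP/negbTE st; rewrite KE st mul0r.
  - by move=> st /(_ (lt_trans s0 st)) [].
have mexp (A : set R) : measurable_fun A (fun t : R => expR (- t)).
  by apply: measurable_funTS; apply: (measurableT_comp (@measurable_expR R)).
rewrite ge0_integralZl_real; last 4 first.
- exact: measurable_itv.
- exact: mexp.
- by move=> x _; exact: expR_ge0.
- exact: mulr_ge0 (ltW p0) (powR_ge0 _ _).
rewrite integral_itv_obnd_cbnd; last exact/measurable_EFinP.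
by rewrite integral_expRN -!EFinM /Euler_density mulrA.
Qed.

(** Finite because t^p <= 1 + t for 0 < p < 1, and both exp (- t) and t exp (- t) have integral
    1. *)
Lemma Euler_integral_spec (p : R) : 0 < p -> p < 1 ->
  exists2 c : R, 0 < c &
  (\int[mu]_(t in `]0%R, +oo[) (Euler_density p t)%:E = c%:E)%E.
Proof.
move=> p0 p1.
have mexp (D : set R) : measurable_fun D (fun t : R => (expR (- t))%:E).
  apply/measurable_EFinP; apply: measurable_funTS.
  by apply: (measurableT_comp (@measurable_expR R)).
have I0 : (\int[mu]_(t in `]0%R, +oo[) (expR (- t))%:E = 1)%E.
  by rewrite integral_itv_obnd_cbnd// integral_expRN oppr0 expR0.
have I1 : (\int[mu]_(t in `]0%R, +oo[) (Euler_density 1 t)%:E = 1)%E.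
  rewrite integral_Euler_density_rec// mul1e -I0; apply: eq_integral => t _.
  by rewrite subrr /Euler_density powRr0 mul1r.
have Ifin : (\int[mu]_(t in `]0%R, +oo[) (Euler_density p t)%:E < +oo)%E.
  apply: (@le_lt_trans _ _ (\int[mu]_(t in `]0%R, +oo[)
    ((expR (- t))%:E + (Euler_density 1 t)%:E))%E).
    apply: ge0_le_integral => //.
    - by move=> x _; rewrite lee_fin Euler_density_ge0.
    - by apply/measurable_EFinP; exact: measurable_Euler_density.
    - apply: emeasurable_funD; first exact: mexp.
      by apply/measurable_EFinP; exact: measurable_Euler_density.
    - move=> t; rewrite /= in_itv/= andbT => t0.
      rewrite -EFinD lee_fin /Euler_density -{2}[expR (- t)]mul1r -mulrDl.
      apply: ler_wpM2r; first exact: expR_ge0.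
      rewrite powRr1; last exact: ltW.
      have [t1|t1] := leP t 1.
        apply: (@le_trans _ _ 1); last by rewrite lerDl ltW.
        have := @ge0_ler_powR R p (ltW p0) t 1; rewrite powR1.
        by apply => //; rewrite nnegrE ?ler01// ltW.
      apply: (@le_trans _ _ t); last by lra.
      by have := ler_powR (ltW t1) (ltW p1); rewrite (powRr1 (ltW t0)).
  rewrite ge0_integralD//=.
  - by rewrite I0 I1 -EFinD ltry.
  - exact: mexp.
  - by move=> x _; rewrite lee_fin Euler_density_ge0.
  - by apply/measurable_EFinP; exact: measurable_Euler_density.
exists (fine (\int[mu]_(t in `]0%R, +oo[) (Euler_density p t)%:E)%E).
  apply: fine_gt0; rewrite Ifin andbT; apply: integral_gt0 => //.
  - by rewrite lebesgue_measure_itv/= ltry addye// lt0y.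
  - exact: measurable_Euler_density.
  - by move=> x; rewrite /= in_itv/= andbT => x0; rewrite mulr_gt0 ?powR_gt0 ?expR_gt0.
by rewrite fineK// ge0_fin_numE//; apply: integral_ge0 => x _; rewrite lee_fin Euler_density_ge0.
Qed.

(** For 0 < k < 1 the continuation takes a single step, Gamma (- k) = Gamma (1 - k) / (- k), while
    Gamma (2 - k) = (1 - k) Gamma (1 - k). The identity converts the factor 1 / Gamma (- k) of
    [varkappa] into the constant of the theorem. *)
Lemma Gamma_spec (k : R) : 0 < k -> k < 1 ->
  0 < Gamma (2 - k) /\ Gamma (2 - k) = - (k * (1 - k)) * Gamma (- k).
Proof.
move=> k0 k1.
have q0 : 0 < 1 - k by rewrite subr_gt0.
have q1 : 1 - k < 1 by rewrite ltrBlDr ltrDl.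
have [c c0 Ic] := Euler_integral_spec q0 q1.
have G2 : Gamma (2 - k) = c.
  rewrite /Gamma ifT; last by lra.
  rewrite big_ord0 divr1 addr0 /Euler_integral /Rintegral.
  have -> : 2 - k - 1 = 1 - k by lra.
  by rewrite [X in fine X](_ : _ = c%:E).
rewrite G2; split => //.
have kn0 : k != 0 by rewrite gt_eqF.
have k1n0 : 1 - k != 0 by rewrite gt_eqF.
rewrite /Gamma ifF; last by lra.
rewrite (_ : Num.truncn _ = 0%N); last first.
  by apply/truncn0Pn; rewrite opprK -ltNge.
rewrite big_ord1/= addr0 /Euler_integral /Rintegral.
have -> : - k + 1%:R - 1 = 1 - k - 1 by lra.
rewrite [X in fine X](_ : _ = (c / (1 - k))%:E).
  by rewrite /=; field; rewrite kn0 k1n0.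
(* Dividing the recursion by 1 - k evaluates the integral with exponent - k, and so also shows that
   it is finite. *)
have := integral_Euler_density_rec q0; rewrite Ic => e.
have : ((1 - k)^-1%:E * c%:E = (1 - k)^-1%:E * ((1 - k)%:E *
    \int[mu]_(t in `]0%R, +oo[) (Euler_density (1 - k - 1) t)%:E))%E.
  by rewrite -e.
by rewrite muleA -!EFinM mulVf// mul1e mulrC => ->.
Qed.

End min_kernel_and_Gamma.

(** * Absolutely continuous functions *)

Section absolutely_continuous.
Context {R : realType}.
Local Notation mu := (@lebesgue_measure R).

Lemma sum_length_le_measure (n : nat) (u v : 'I_n -> R) (U : set R) :
  measurable U -> (forall i, u i <= v i) ->
  trivIset setT (fun i => `]u i, v i[%classic : set R) ->
  (forall i, `]u i, v i[%classic `<=` U) ->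
  ((\sum_(i < n) (v i - u i))%:E <= mu U)%E.
Proof.
move=> mU uv tI sub.
have mI (i : 'I_n) : measurable (`]u i, v i[%classic : set R) by exact: measurable_itv.
have -> : ((\sum_(i < n) (v i - u i))%:E =
    mu (\big[setU/set0]_(i < n) `]u i, v i[%classic))%E.
  rewrite measure_bigsetU_ord// -sumEFin; apply: eq_bigr => i _.
  transitivity (mu (`]u i, v i[%classic : set R)); last by [].
  rewrite lebesgue_measure_itv/= lte_fin; case: ltP => // vu.
  have -> : u i = v i by apply/le_anti; rewrite uv vu.
  by rewrite subrr.
apply: le_measure; rewrite ?inE//.
- by apply: bigsetU_measurable => i _.
- apply: (big_ind (fun A => A `<=` U)) => //.
  by move=> A B AU BU x []; [exact: AU|exact: BU].
Qed.

Lemma open_cover_null (N : set R) (d : R) : mu.-negligible N -> 0 < d ->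
  exists U : set R, [/\ open U, N `<=` U & (mu U < d%:E)%E].
Proof.
move=> [M [mM M0' NM]] d0; have M0 : mu M = 0%E := M0'.
have MI : (mu M < +oo)%E by rewrite M0.
have [U [oU MU dU]] := lebesgue_regularity_outer mM MI d0.
exists U; split => //; first exact: subset_trans MU.
have mU : measurable U by exact: open_measurable.
apply: le_lt_trans dU.
rewrite -[leRHS]adde0 -M0 addeC -measureU//; last 2 first.
- exact: measurableD.
- by rewrite setDIK.
apply: le_measure; rewrite ?inE//; first by apply: measurableU => //; exact: measurableD.
by rewrite setDUK.
Qed.

(* Real induction: the increments at points where G' = 0 are controlled by the
   length, those at the points of the exceptional null set by absolute
   continuity. *)
Lemma abs_continuous_deriv0 (a b : R) (G : R -> R) : a <= b ->
  abs_continuous a b G ->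
  {ae mu, forall x, a <= x <= b -> forall e, 0 < e ->
    exists2 d, 0 < d & forall y, a <= y <= b -> `|y - x| < d ->
      `|G y - G x| <= e * `|y - x| } ->
  G b = G a.
Proof.
move=> ab AC dG; apply/eqP; rewrite -subr_eq0 -normr_le0.
apply/ler_addgt0Pr => e0 e00; rewrite add0r.
(* The total budget is e (b - a) for the points where the derivative is 0, plus e for the intervals
   inside U. *)
pose e := e0 / (b - a + 1).
have ba1 : 0 < b - a + 1 by rewrite ltr_wpDl// subr_ge0.
have e_gt0 : 0 < e by rewrite divr_gt0.
have [d d0 ACd] := AC e e_gt0.
have [U [oU NU Ud]] := open_cover_null dG d0.
have mU : measurable U by exact: open_measurable.
(* A certificate for [a, x]: ordered intervals inside U whose increments are to be charged to
   absolute continuity, the rest of the increment being at most e times the length. *)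
pose chain x (n : nat) (u v : nat -> R) := [/\
  forall i, (i < n)%N -> [/\ a <= u i, u i <= v i, v i <= x & `[u i, v i] `<=` U],
  forall i j, (i < j)%N -> (j < n)%N -> v i <= u j &
  `|G x - G a| <= e * (x - a) + \sum_(i < n) `|G (v i) - G (u i)| ].
pose S := [set x | a <= x <= b /\ exists n u v, chain x n u v].
have Sa : S a.
  split; first by rewrite lexx.
  exists 0%N, (fun=> 0), (fun=> 0); split => //.
  by rewrite !subrr normr0 mulr0 big_ord0 addr0.
(* Near any c, a certificate extends from a point x on the left of c to a point y on its right:
   either the vanishing derivative at c pays e (y - x), or c is in U and [x, y] is appended to the
   list of intervals. *)
have step c : a <= c <= b -> exists2 r, 0 < r & forall x y, x <= c <= y ->
    `|x - c| < r -> `|y - c| < r -> y <= b -> S x -> S y.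
  move=> cab.
  have [[r r0 Gr]|Uc] : (exists2 d, 0 < d & forall y, a <= y <= b -> `|y - c| < d ->
      `|G y - G c| <= e * `|y - c|) \/ U c.
    have [?|nUc] := pselect (U c); first by right.
    left; have : ~ [set x | ~ (a <= x <= b -> forall e, 0 < e ->
    exists2 d, 0 < d & forall y, a <= y <= b -> `|y - x| < d ->
      `|G y - G x| <= e * `|y - x| )] c by move=> /NU.
    by move=> /contrapT /(_ cab _ e_gt0).
  - exists r => // x y /andP[xc cy] xr yr yb [xab [n [u [v [h1 h2 h3]]]]].
    have yab : a <= y <= b by lra.
    split => //; exists n, u, v; split => //.
      by move=> i /h1[? ? vx ?]; split => //; lra.
    have := Gr x xab xr; have := Gr y yab yr.
    rewrite (ger0_norm (_ : 0 <= y - c)); last by lra.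
    rewrite (ler0_norm (_ : x - c <= 0)); last by lra.
    move=> k1 k2.
    have -> : G y - G a = (G y - G c) - (G x - G c) + (G x - G a) by lra.
    apply: le_trans (ler_normD _ _) _.
    apply: le_trans (lerD (ler_normB _ _) (lexx _)) _.
    by lra.
  - have /nbhs_ballP[r /= r0 rU] : nbhs c U by exact: open_nbhs_nbhs.
    exists r => // x y /andP[xc cy] xr yr yb [xab [n [u [v [h1 h2 h3]]]]].
    have yab : a <= y <= b by lra.
    split => //; exists n.+1, (fun i => if i == n then x else u i),
      (fun i => if i == n then y else v i); split.
    + move=> i; rewrite ltnS leq_eqVlt; case: eqP => [_ _|_ /= /h1[? ? ? ?]]; split => //; try lra.
      move=> z /=; rewrite in_itv/= => /andP[xz zy]; apply: rU.
      by rewrite /ball/= ltr_norml; move: xr yr; rewrite !ltr_norml; lra.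
    + move=> i j ij; rewrite ltnS leq_eqVlt => /predU1P[jn|jn].
        rewrite jn eqxx ltn_eqF -?jn//.
        by have [] := h1 i (leq_trans ij (eq_leq jn)).
      by rewrite !ltn_eqF ?(ltn_trans ij)//; exact: h2.
    + rewrite big_ord_recr/= eqxx.
      under eq_bigr => i _ do rewrite ltn_eqF//.
      have -> : G y - G a = (G x - G a) + (G y - G x) by lra.
      apply: le_trans (ler_normD _ _) _.
      rewrite addrA lerD2r; apply: le_trans h3 _.
      by rewrite lerD2r ler_pM2l// lerD2r; lra.
(* Start from a point of S just below sup S and step across sup S: the point y reached is b, or else
   exceeds sup S, which is absurd. *)
have Sb : S b.
  have hS : has_sup S by split; [exists a | exists b => x [/andP[]]].
  have sS := sup_upper_bound hS.
  have csb : a <= sup S <= b.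
    by rewrite sS//=; apply: ge_sup; [exists a | move=> x [/andP[]]].
  have [r r0 hr] := step _ csb.
  have [x Sx xs] := sup_adherent r0 hS.
  have xs' : x <= sup S by exact: sS.
  pose y := Num.min b (sup S + r / 2).
  have yb : y <= b by rewrite ge_min lexx.
  have sy : sup S <= y by rewrite le_min; lra.
  have yr : y <= sup S + r / 2 by rewrite ge_min lexx orbT.
  have Sy : S y.
    apply: (hr x y) => //; rewrite ?xs'//; rewrite ltr_norml; lra.
  have : y = b \/ y = sup S + r / 2.
    by rewrite /y; case: (leP b) => _; [left|right].
  case=> [<-//|yE]; have := sS _ Sy; lra.
have [_ [n [u [v [h1 h2 h3]]]]] := Sb.
apply: le_trans h3 _.
have tI : trivIset [set: 'I_n] (fun i => `]u i, v i[%classic : set R).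
  have dis (i j : 'I_n) : (i < j)%N ->
      `]u i, v i[%classic `&` `]u j, v j[%classic = set0.
    move=> ij; rewrite -subset0 => z [] /=; rewrite !in_itv/= => zi zj.
    by have := h2 _ _ ij (ltn_ord j); lra.
  apply/trivIsetP => i j _ _; rewrite neq_ltn.
  by case/orP => /dis; rewrite // setIC.
have : \sum_(i < n) `|G (v i) - G (u i)| < e.
  apply: ACd.
  - by move=> i; have [] := h1 i (ltn_ord i).
  - exact: tI.
  - rewrite -lte_fin; apply: le_lt_trans Ud; apply: sum_length_le_measure => //.
    + by move=> i; have [] := h1 i (ltn_ord i).
    + move=> i x xi; have [_ _ _] := h1 i (ltn_ord i); apply.
      by move: xi; exact: subset_itv_oo_cc.
have : e * (b - a) + e = e0 by rewrite /e; field; rewrite gt_eqF.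
lra.
Qed.

End absolutely_continuous.

(** * Derivatives relative to a set, in epsilon form *)

Section derivative_epsilon.
Context {R : realType}.

(** Differentiability along D without division: one notion covers the two-sided derivative, the
    one-sided derivative at 0 and restriction to an interval, and it passes to subsets. *)
Definition linear_approx (D : set R) (f : R -> R) (x l : R) :=
  forall e, 0 < e -> exists2 d, 0 < d &
    forall y, D y -> `|y - x| < d -> `|f y - f x - l * (y - x)| <= e * `|y - x|.

Lemma linear_approxS (D1 D2 : set R) f x l : D1 `<=` D2 ->
  linear_approx D2 f x l -> linear_approx D1 f x l.
Proof.
move=> D12 H e /H[d d0 Hd]; exists d => // y /D12; exact: Hd.
Qed.

Lemma quotient_sub (a b l z : R) : z != 0 ->
  `|l - (a - b) / z| = `|a - b - l * z| / `|z|.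
Proof.
move=> z0; rewrite -normfV -normrM -normrN; congr `|_|.
by field.
Qed.

Lemma has_derivP (f : R -> R) (x l : R) :
  has_deriv f x l <-> linear_approx Rp f x l.
Proof.
split.
- move=> /cvgrPdist_le H e e0.
  have := H e e0; rewrite near_withinE => /nbhs_ballP[d /= d0 Hd].
  exists d => // y Ry yx.
  have [->|yneq] := eqVneq y x; first by rewrite !subrr mulr0 subr0 normr0 mulr0.
  have zn : y - x != 0 by rewrite subr_eq0.
  have := Hd (y - x); rewrite /ball/= sub0r normrN => /(_ yx zn).
  rewrite subrKC => /(_ Ry).
  by rewrite quotient_sub// ler_pdivrMr// normr_gt0.
- move=> H; apply/cvgrPdist_le => e e0.
  have [d d0 Hd] := H e e0.
  rewrite near_withinE; apply/nbhs_ballP; exists d => // z /=.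
  rewrite /ball/= sub0r normrN => zd z0 Rz.
  rewrite quotient_sub// ler_pdivrMr ?normr_gt0//.
  have := Hd (x + z) Rz; rewrite -addrAC subrr add0r.
  exact.
Qed.

Lemma is_derive_linear_approx (D : set R) (f : R -> R) (x l : R) :
  is_derive x 1 f l -> linear_approx D f x l.
Proof.
move=> [df dl] e e0.
have : (fun h : R => h^-1 *: ((f \o shift x) (h *: 1) - f x)) @ 0^' --> l.
  by rewrite -dl.
move=> /cvgrPdist_le /(_ e e0) /nbhs_ballP[d /= d0 Hd].
exists d => // y _ yx.
have [->|yneq] := eqVneq y x; first by rewrite !subrr mulr0 subr0 normr0 mulr0.
have zn : y - x != 0 by rewrite subr_eq0.
have := Hd (y - x); rewrite /ball/= sub0r normrN => /(_ yx zn).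
rewrite /GRing.scale/= mulr1 subrK mulrC.
by rewrite quotient_sub// ler_pdivrMr// normr_gt0.
Qed.

Lemma linear_approxB (D : set R) (f g : R -> R) (x l m : R) :
  linear_approx D f x l -> linear_approx D g x m ->
  linear_approx D (f \- g) x (l - m).
Proof.
move=> Hf Hg e e0.
have e20 : 0 < e / 2 by lra.
have [d1 d10 H1] := Hf _ e20; have [d2 d20 H2] := Hg _ e20.
exists (Num.min d1 d2); first by rewrite lt_min d10.
move=> y Dy; rewrite lt_min => /andP[y1 y2].
have := H1 y Dy y1; have := H2 y Dy y2; move=> k2 k1.
rewrite (_ : (f \- g) y - _ - _ =
  (f y - f x - l * (y - x)) - (g y - g x - m * (y - x))); last by rewrite /=; ring.
apply: le_trans (ler_normB _ _) _.
by have := lerD k1 k2; rewrite -mulrDl -splitr.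
Qed.

Lemma linear_approx_shift (f : R -> R) (x y l : R) : Rp x ->
  linear_approx Rp f (y + x) l -> linear_approx Rp (fun t => f (t + x)) y l.
Proof.
rewrite /Rp/= in_itv/= andbT => x0 H e /H[d d0 Hd]; exists d => // z Rz zy.
have := Hd (z + x); rewrite /Rp/= in_itv/= andbT addr_ge0//; last first.
  by move: Rz; rewrite /Rp/= in_itv/= andbT.
have -> : z + x - (y + x) = z - y by ring.
exact.
Qed.

End derivative_epsilon.

(** * Absolutely continuous functions and the integral of their derivative *)

Section AC_integral.
Context {R : realType}.
Local Notation mu := (@lebesgue_measure R).

Lemma abs_continuousB (a b : R) (f g : R -> R) :
  abs_continuous a b f -> abs_continuous a b g -> abs_continuous a b (f \- g).
Proof.
move=> Hf Hg e e0.
have e20 : 0 < e / 2 by lra.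
have [d1 d10 H1] := Hf _ e20; have [d2 d20 H2] := Hg _ e20.
exists (Num.min d1 d2); first by rewrite lt_min d10.
move=> n u v uv tI; rewrite lt_min => /andP[s1 s2].
have k1 := H1 n u v uv tI s1; have k2 := H2 n u v uv tI s2.
apply: (@le_lt_trans _ _ (\sum_(i < n) (`|f (v i) - f (u i)| + `|g (v i) - g (u i)|))).
  apply: ler_sum => i _.
  rewrite (_ : _ - _ = (f (v i) - f (u i)) - (g (v i) - g (u i))); last by rewrite /=; ring.
  exact: ler_normB.
by rewrite big_split/= (splitr e) ltrD.
Qed.

Lemma integral_increment (g : R -> R) (u v : R) : u <= v ->
  mu.-integrable setT (EFin \o g) ->
  \int[mu]_(t in `]-oo, v]) g t - \int[mu]_(t in `]-oo, u]) g t =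
  \int[mu]_(t in `]u, v]) g t.
Proof.
move=> uv ig.
have -> : (`]-oo, v]%classic : set R) = `]-oo, u] `|` `]u, v].
  by rewrite -itv_bndbnd_setU//= bnd_simp.
rewrite Rintegral_setU//=.
- by rewrite addrAC subrr add0r.
- by rewrite -itv_bndbnd_setU//= ?bnd_simp//; apply: integrableS ig.
- rewrite disj_set2E; apply/eqP; rewrite -subset0 => x [] /=; rewrite !in_itv/=.
  by move=> xu /andP[]; rewrite ltNge xu.
Qed.

(** The intervals are disjoint, so the increments add up to at most the integral of |g| over their
    union, and this is small once the measure of the union, which is the total length, is small. *)
Lemma abs_continuous_integral (a b : R) (g : R -> R) :
  mu.-integrable setT (EFin \o g) ->
  abs_continuous a b (fun y => \int[mu]_(t in `]-oo, y]) g t).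
Proof.
move=> ig e e0; have [d [d0 Hd]] := integral_normr_continuous ig e0.
exists d => // n u v uv tI sd.
pose A := \big[setU/set0]_(i < n) `]u i, v i[%classic : set R.
have mI (i : 'I_n) : measurable (`]u i, v i[%classic : set R) by exact: measurable_itv.
have mA : measurable A by apply: bigsetU_measurable.
have muA : mu A = (\sum_(i < n) (v i - u i))%:E.
  rewrite /A measure_bigsetU_ord// -sumEFin; apply: eq_bigr => i _.
  transitivity (mu (`]u i, v i[%classic : set R)); first by [].
  have [_ uvi _] := uv i.
  rewrite lebesgue_measure_itv/= lte_fin; case: ltP => // vu.
  have -> : u i = v i by apply/le_anti; rewrite uvi vu.
  by rewrite subrr.
have muAd : (mu A < d%:E)%E by rewrite muA lte_fin.
apply: le_lt_trans (Hd A mA muAd).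
have inA (B : set R) : measurable B -> mu.-integrable B (EFin \o (fun t => `|g t|)).
  move=> mB; rewrite (_ : _ \o _ = abse \o (EFin \o g)); last by [].
  by apply: integrable_abse; exact: integrableS ig.
rewrite -lee_fin /Rintegral fineK; last exact: integrable_fin_num (inA _ mA).
rewrite /A ge0_integral_bigsetU//; last 3 first.
- exact: index_enum_uniq.
- by move=> i j _ _; exact: tI.
- by have := inA _ mA; case/integrableP.
rewrite -sumEFin; apply: lee_sum => i _.
have [_ uvi _] := uv i.
rewrite (integral_increment uvi ig).
have mg : measurable_fun (`]u i, v i] : set R) (EFin \o (fun t => `|g t|)).
  by have /integrableP[] := inA _ (measurable_itv `]u i, v i]).
rewrite -[leRHS]fineK; last exact: integrable_fin_num (inA _ (mI i)).
rewrite lee_fin.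
apply: le_trans (le_normr_Rintegral _ _) _ => //.
  by apply: integrableS ig.
rewrite /Rintegral integral_itv_bndo_bndc//.
by apply: measurable_funS mg => //; exact: subset_itv_oo_oc.
Qed.

(** If the right-hand side is infinite there is nothing to prove. Otherwise subtract from F the
    primitive of f: by Lebesgue differentiation the difference has derivative 0 a.e., and it is
    absolutely continuous, hence takes the same value at a and b. *)
Lemma abs_continuous_le_integral (a b : R) (F f : R -> R) : a <= b ->
  abs_continuous a b F -> measurable_fun `[a, b] f ->
  {ae mu, forall x, a <= x <= b -> linear_approx `[a, b]%classic F x (f x)} ->
  (`|F b - F a|%:E <= \int[mu]_(x in `[a, b]) `|f x|%:E)%E.
Proof.
move=> ab AC mf dF.
have mab : measurable (`[a, b]%classic : set R) by exact: measurable_itv.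
have [Iy|Iy] := leP +oo%E (\int[mu]_(x in `[a, b]) `|f x|%:E)%E.
  by apply: le_trans Iy; rewrite leey.
have fab : mu.-integrable `[a, b] (EFin \o f).
  by apply/integrableP; split => //; exact/measurable_EFinP.
pose g := f \_ `[a, b].
have ig : mu.-integrable setT (EFin \o g).
  by rewrite /g -restrict_EFin; apply/integrable_restrict => //=; rewrite setTI.
pose H y := \int[mu]_(t in `]-oo, y]) g t.
have H' : {ae mu, forall x, derivable H x 1 /\ H^`()%classic x = g x}.
  by apply: FTC1Ny; [move=> y; exact: integrableS ig | exact: integrable_locally].
have : (F \- H) b = (F \- H) a.
  apply: abs_continuous_deriv0 => //.
    by apply: abs_continuousB => //; exact: abs_continuous_integral.
  move: dF H'; apply: filterS2; first exact: (ae_filter_ringOfSetsType mu).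
  move=> x Fx [dH Hx] xab.
  have := linear_approxB (Fx xab) (is_derive_linear_approx `[a, b] (DeriveDef dH erefl)).
  rewrite -derive1E Hx /g patchE mem_set; last exact: xab.
  rewrite subrr => K e e0; have [d d0 Hd] := K e e0.
  exists d => // y yab yx; have := Hd y; rewrite /= in_itv/= mul0r subr0.
  exact.
move=> E; have -> : F b - F a = H b - H a by move: E => /=; lra.
rewrite (integral_increment ab ig) (EFin_normr_Rintegral _ _ ); last 2 first.
- exact: measurable_itv.
- exact: integrableS ig.
apply: le_trans (le_abse_integral _ _ _) _ => //.
  by have /integrableP[+ _] := ig; exact: measurable_funS.
rewrite integral_itv_obnd_cbnd; last first.
  apply: measurableT_comp => //.
  by have /integrableP[+ _] := ig; exact: measurable_funS.
apply: ge0_le_integral => //.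
- apply: measurableT_comp => //.
  by have /integrableP[+ _] := ig; exact: measurable_funS.
- by apply/measurable_EFinP; apply: measurableT_comp.
- by move=> x xab; rewrite /g patchE mem_set.
Qed.

End AC_integral.

Section halfline_calculus.
Context {R : realType}.
Local Notation mu := (@lebesgue_measure R).

Lemma linear_approx_is_derive (D : set R) (f : R -> R) (x l r : R) : 0 < r ->
  (forall y, `|y - x| < r -> D y) ->
  linear_approx D f x l -> is_derive x 1 f l.
Proof.
move=> r0 xD H.
have c : (fun h : R => h^-1 *: ((f \o shift x) (h *: 1) - f x)) @ 0^' --> l.
  apply/cvgrPdist_le => e e0; have [d d0 Hd] := H e e0.
  apply/nbhs_ballP; exists (Num.min d r); first by rewrite /= lt_min d0.
  move=> z /=; rewrite /ball/= sub0r normrN lt_min => /andP[zd zr] z0.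
  rewrite /GRing.scale/= mulr1 mulrC quotient_sub// ler_pdivrMr ?normr_gt0//.
  have e1 : z + x - x = z by rewrite addrK.
  by have := Hd (z + x); rewrite e1; apply => //; apply: xD; rewrite e1.
split; first by apply/cvg_ex; exists l.
by apply/cvg_lim.
Qed.

Lemma eps_continuous_within (a b : R) (f : R -> R) : a < b ->
  (forall x e, a <= x <= b -> 0 < e -> exists2 d, 0 < d &
    forall y, a <= y <= b -> `|y - x| < d -> `|f y - f x| <= e) ->
  {within `[a, b], continuous f}.
Proof.
move=> ab H; apply/continuous_within_itvP => //; split.
- move=> x; rewrite in_itv/= => /andP[ax xb].
  apply/cvgrPdist_le => e e0.
  have [|d d0 Hd] := H x e _ e0; first by rewrite !ltW.
  near=> y; rewrite distrC; apply: Hd.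
    by apply/andP; split; apply: ltW; near: y; [exact: lt_nbhsr|exact: lt_nbhsl].
  by rewrite distrC; near: y; apply: (@cvgr_dist_lt _ _ _ (nbhs x) _ id).
- apply/cvgrPdist_le => e e0.
  have [|d d0 Hd] := H a e _ e0; first by rewrite lexx ltW.
  near=> y; rewrite distrC; apply: Hd.
    by apply/andP; split; near: y; [exact: nbhs_right_ge|exact: nbhs_right_le].
  rewrite ger0_norm ?ltrBlDl; last by rewrite subr_ge0; near: y; exact: nbhs_right_ge.
  by near: y; apply: nbhs_right_lt; rewrite ltrDl.
- apply/cvgrPdist_le => e e0.
  have [|d d0 Hd] := H b e _ e0; first by rewrite lexx ltW.
  near=> y; rewrite distrC; apply: Hd.
    by apply/andP; split; near: y; [exact: nbhs_left_ge|exact: nbhs_left_le].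
  rewrite ler0_norm ?opprB; last by rewrite subr_le0; near: y; exact: nbhs_left_le.
  by rewrite ltrBlDl -ltrBlDr; near: y; apply: nbhs_left_gt; rewrite ltrBlDr ltrDl.
Unshelve. all: by end_near. Qed.

Lemma linear_approx_continuous (D : set R) (f : R -> R) (x l e : R) : 0 < e ->
  linear_approx D f x l -> exists2 d, 0 < d &
    forall y, D y -> `|y - x| < d -> `|f y - f x| <= e.
Proof.
move=> e0 /(_ 1 ltr01)[d d0 Hd].
pose c := `|l| + 1.
have c0 : 0 < c by rewrite ltr_wpDl.
exists (Num.min d (e / c)); first by rewrite lt_min d0 divr_gt0.
move=> y Dy; rewrite lt_min ltr_pdivlMr// => /andP[yd yc].
have := Hd y Dy yd => k.
rewrite (_ : f y - f x = (f y - f x - l * (y - x)) + l * (y - x)); last by ring.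
apply: le_trans (ler_normD _ _) _.
apply: le_trans (lerD k (lexx _)) _.
by rewrite normrM -mulrDl addrC mulrC ltW.
Qed.

Lemma abs_continuous_eps (a b e : R) (f : R -> R) : 0 < e ->
  abs_continuous a b f -> exists2 d, 0 < d &
    forall x y, a <= x <= b -> a <= y <= b -> `|y - x| < d -> `|f y - f x| <= e.
Proof.
move=> e0 /(_ e e0)[d d0 Hd]; exists d => //.
have key x y : a <= x -> x <= y -> y <= b -> y - x < d -> `|f y - f x| <= e.
  move=> ax xy yb xyd.
  have := Hd 1%N (fun=> x) (fun=> y); rewrite !big_ord1 => /(_ _ _ xyd)/ltW; apply.
    by move=> _; split.
  by move=> i j _ _ _; rewrite !ord1.
move=> x y /andP[ax xb] /andP[ay yb] xyd.
have [xy|yx] := leP x y.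
  by apply: key => //; apply: le_lt_trans xyd; exact: ler_norm.
rewrite distrC; apply: key => //; first exact: ltW.
by apply: le_lt_trans xyd; rewrite distrC; exact: ler_norm.
Qed.

(** Absolute continuity makes f1 continuous, so the classical theorem applies. At the left endpoint,
    which may be 0, only continuity of f is required. *)
Lemma FTC_halfline (a b : R) (f f1 : R -> R) : 0 <= a -> a < b ->
  (forall x, Rp x -> linear_approx Rp f x (f1 x)) ->
  abs_continuous a b f1 ->
  (\int[mu]_(x in `[a, b]) (f1 x)%:E = (f b - f a)%:E)%E.
Proof.
move=> a0 ab df AC.
have RpP x : a <= x -> Rp x by move=> ax; rewrite /Rp/= in_itv/= andbT (le_trans a0).
have cf : {within `[a, b], continuous f}.
  apply: eps_continuous_within => // x e /andP[ax xb] e0.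
  have [d d0 Hd] := linear_approx_continuous e0 (df _ (RpP _ ax)).
  by exists d => // y /andP[ay _]; apply: Hd; exact: RpP.
have cf1 : {within `[a, b], continuous f1}.
  apply: eps_continuous_within => // x e xab e0.
  have [d d0 Hd] := abs_continuous_eps e0 AC.
  by exists d => // y yab; exact: Hd.
have df' x : a < x -> is_derive x 1 f (f1 x).
  move=> ax; apply: (@linear_approx_is_derive Rp _ _ _ (x - a)).
  - by rewrite subr_gt0.
  - by move=> y; rewrite ltr_norml => /andP[yx _]; apply: RpP; lra.
  - by apply: df; apply: RpP; exact: ltW.
rewrite (@continuous_FTC2 _ f1 f)// ?EFinB//.
- have /(continuous_within_itvP _ ab)[_ ca cb] := cf.
  split => //.
  by move=> x; rewrite in_itv/= => /andP[/df'[]].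
- by move=> x; rewrite in_itv/= => /andP[/df'[_ <-] _]; rewrite derive1E.
Qed.

End halfline_calculus.

(** * Taylor remainders and the Marchaud integral *)

Section Taylor.
Context {R : realType}.
Local Notation mu := (@lebesgue_measure R).
Variables (phi psi v : R -> R) (a b : R).
Hypotheses (a0 : 0 <= a) (ab : a < b).
Hypothesis dphi : forall x, Rp x -> linear_approx Rp phi x (psi x).
Hypothesis AC : abs_continuous a b psi.
Hypothesis mv : measurable_fun `[a, b] v.
Hypothesis v0 : forall x, 0 <= v x.
(** All that is retained of the second derivative; it will be applied with v the absolute value of a
    translate of f''. *)
Hypothesis psi_v : forall x y, a <= x -> x <= y -> y <= b ->
  (`|psi y - psi x|%:E <= \int[mu]_(s in `[x, y]) (v s)%:E)%E.

Let D : set R := `[a, b]%classic.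
Let mD : measurable D. Proof. exact: measurable_itv. Qed.

Let mpsi : measurable_fun D psi.
Proof.
apply: subspace_continuous_measurable_fun => //.
apply: eps_continuous_within => // x e xab e0.
have [d d0 Hd] := abs_continuous_eps e0 AC.
by exists d => // y yab; exact: Hd.
Qed.

Lemma Taylor_increment (c : R) :
  (`|phi b - phi a - c * (b - a)|%:E <=
   \int[mu]_(y in D) `|psi y - c|%:E)%E.
Proof.
have dphi' x : Rp x ->
    linear_approx Rp (fun y => phi y - c * y) x (psi x - c).
  move=> Rx; apply: linear_approxB; first exact: dphi.
  move=> e e0; exists 1 => // y _ _.
  by rewrite -mulrBr subrr normr0 mulr_ge0// ltW.
have AC' : abs_continuous a b (fun y => psi y - c).
  move=> e /AC[d d0 Hd]; exists d => // n p q pq tI s.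
  by under eq_bigr do rewrite opprB addrA subrK; exact: Hd.
have -> : phi b - phi a - c * (b - a) = (phi b - c * b) - (phi a - c * a) by ring.
rewrite -[X in (X <= _)%E]/(`|((phi b - c * b) - (phi a - c * a))%:E|%E).
rewrite -(FTC_halfline a0 ab dphi' AC').
apply: le_abse_integral => //.
by apply/measurable_EFinP; exact: measurable_funB.
Qed.

(** The remainder is at most the integral over y of |psi y - psi a|, itself at most the integral of
    v over [a, y]. Interchanging on the triangle s <= y, each s is counted for the length b - s. *)
Lemma Taylor_left :
  (`|phi b - phi a - psi a * (b - a)|%:E <=
   \int[mu]_(s in D) ((b - s) * v s)%:E)%E.
Proof.
apply: le_trans (Taylor_increment (psi a)) _.
pose K (y s : R) := (if s <= y then 1 else 0) * v s.
have KE y s : K y s = (if s <= y then 1 else 0) * v s by [].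
have K0 y s : 0 <= K y s by rewrite KE mulr_ge0//; case: ifP.
have mK : measurable_fun (D `*` D) (fun z : R * R => (K z.1 z.2)%:E).
  apply/measurable_EFinP; apply: measurable_funM.
    exact: measurable_fun_ge_indicator.
  exact: measurable_fun_snd.
apply: (@le_trans _ _ (\int[mu]_(y in D) \int[mu]_(s in D) (K y s)%:E)%E).
  apply: ge0_le_integral => //.
  - apply/measurable_EFinP; apply: measurableT_comp => //.
    exact: measurable_funB.
  - by apply: measurable_integral_section => // x y _ _; exact: K0.
  - move=> y; rewrite /D/= in_itv/= => /andP[ay yb].
    apply: le_trans (psi_v (lexx a) ay yb) _.
    rewrite le_eqVlt; apply/orP; left; apply/eqP.
    apply: eq_integral_support => s; rewrite /D/= !in_itv/=.
    + by move=> /andP[_ sy] _; rewrite KE sy mul1r.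
    + by move=> /andP[as_ sy]; rewrite as_ (le_trans sy yb) => /(_ isT) [].
    + move=> /andP[as_ _]; rewrite as_ /= => /negP/negbTE sy.
      by rewrite KE sy mul0r.
rewrite (@ge0_tonelli_in R D D (fun y s => (K y s)%:E) mD mD mK (fun y s _ _ => K0 y s)).
rewrite le_eqVlt; apply/orP; left; apply/eqP.
apply: eq_integral => s; rewrite inE /D/= in_itv/= => /andP[as_ sb].
transitivity (\int[mu]_(y in `[s, b]) (v s)%:E)%E.
  apply: eq_integral_support => y; rewrite /D/= !in_itv/=.
  - by move=> _ /andP[sy _]; rewrite KE sy mul1r.
  - move=> /andP[_ ->]; rewrite andbT => /negP/negbTE sy.
    by rewrite KE sy mul0r.
  - by move=> /andP[sy yb]; rewrite (le_trans as_ sy) yb => /(_ isT) [].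
rewrite integral_cst//.
rewrite /= lebesgue_measure_itv/= lte_fin -EFinB.
case: ltP => sb'; first by rewrite -EFinM mulrC.
have -> : s = b by apply/le_anti; rewrite sb sb'.
by rewrite mule0 subrr mul0r.
Qed.

(** Mirror image, on the triangle y <= s: each s is counted for the length s - a. *)
Lemma Taylor_right :
  (`|phi b - phi a - psi b * (b - a)|%:E <=
   \int[mu]_(s in D) ((s - a) * v s)%:E)%E.
Proof.
apply: le_trans (Taylor_increment (psi b)) _.
pose K (y s : R) := (if y <= s then 1 else 0) * v s.
have KE y s : K y s = (if y <= s then 1 else 0) * v s by [].
have K0 y s : 0 <= K y s by rewrite KE mulr_ge0//; case: ifP.
have mK : measurable_fun (D `*` D) (fun z : R * R => (K z.1 z.2)%:E).
  apply/measurable_EFinP; apply: measurable_funM.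
    exact: measurable_fun_le_indicator.
  exact: measurable_fun_snd.
apply: (@le_trans _ _ (\int[mu]_(y in D) \int[mu]_(s in D) (K y s)%:E)%E).
  apply: ge0_le_integral => //.
  - apply/measurable_EFinP; apply: measurableT_comp => //.
    exact: measurable_funB.
  - by apply: measurable_integral_section => // x y _ _; exact: K0.
  - move=> y; rewrite /D/= in_itv/= => /andP[ay yb].
    rewrite distrC; apply: le_trans (psi_v ay yb (lexx b)) _.
    rewrite le_eqVlt; apply/orP; left; apply/eqP.
    apply: eq_integral_support => s; rewrite /D/= !in_itv/=.
    + by move=> /andP[sy _] _; rewrite KE sy mul1r.
    + by move=> /andP[sy sb]; rewrite sb (le_trans ay sy) => /(_ isT) [].
    + move=> /andP[_ sb]; rewrite sb andbT => /negP/negbTE sy.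
      by rewrite KE sy mul0r.
rewrite (@ge0_tonelli_in R D D (fun y s => (K y s)%:E) mD mD mK (fun y s _ _ => K0 y s)).
rewrite le_eqVlt; apply/orP; left; apply/eqP.
apply: eq_integral => s; rewrite inE /D/= in_itv/= => /andP[as_ sb].
transitivity (\int[mu]_(y in `[a, s]) (v s)%:E)%E.
  apply: eq_integral_support => y; rewrite /D/= !in_itv/=.
  - by move=> _ /andP[_ sy]; rewrite KE sy mul1r.
  - move=> /andP[-> _]; rewrite /= => /negP/negbTE sy.
    by rewrite KE sy mul0r.
  - by move=> /andP[ay ys]; rewrite (le_trans ys sb) ay => /(_ isT) [].
rewrite integral_cst//.
rewrite /= lebesgue_measure_itv/= lte_fin -EFinB.
case: ltP => sb'; first by rewrite -EFinM mulrC.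
have -> : s = a by apply/le_anti; rewrite as_ sb'.
by rewrite mule0 subrr mul0r.
Qed.

End Taylor.

(** * The kernel K and its integral tau_h *)

Section Marchaud_kernel.
Context {R : realType}.
Local Notation mu := (@lebesgue_measure R).

(* For t <= h this is the Green function of - d^2/ds^2 on [0, h]. *)
Definition hat_kernel (h t s : R) := Num.min s t - Num.min h t * (s / h).

Lemma hat_kernelE_le (h t s : R) : 0 < h -> s <= t -> t <= h ->
  hat_kernel h t s = (1 - t / h) * s.
Proof.
by move=> h0 st th; rewrite /hat_kernel min_l// min_r//; field; rewrite gt_eqF.
Qed.

Lemma hat_kernelE_ge (h t s : R) : 0 < h -> t <= s -> t <= h ->
  hat_kernel h t s = t / h * (h - s).
Proof.
by move=> h0 st th; rewrite /hat_kernel min_r// min_r//; field; rewrite gt_eqF.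
Qed.

(** For t <= h the kernel is a tent on [0, h] with apex at s = t; for t > h it is identically 0 on
    [0, h]. *)
Lemma hat_kernel_ge0 (h t s : R) : 0 < h -> 0 <= t -> 0 <= s -> s <= h ->
  0 <= hat_kernel h t s.
Proof.
move=> h0 t0 s0 sh; have [th|ht] := leP t h.
- have [st|ts] := leP s t.
    by rewrite hat_kernelE_le// mulr_ge0// subr_ge0 ler_pdivrMr// mul1r.
  by rewrite hat_kernelE_ge ?(ltW ts)// mulr_ge0 ?divr_ge0 ?subr_ge0// ltW.
- rewrite /hat_kernel min_l ?(le_trans sh (ltW ht))// min_l ?(ltW ht)//.
  by rewrite mulrC divfK ?gt_eqF// subrr.
Qed.

Lemma measurable_hat_kernel_pair (h : R) (D : set (R * R)) :
  measurable_fun D (fun z : R * R => hat_kernel h z.1 z.2).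
Proof.
apply: measurable_funTS; apply: measurable_funB.
  by apply: measurable_minr; [exact: measurable_snd|exact: measurable_fst].
apply: measurable_funM.
  by apply: measurable_minr => //; exact: measurable_fst.
by apply: measurable_funM => //; exact: measurable_snd.
Qed.

Lemma measurable_hat_kernel (h s : R) (D : set R) :
  measurable_fun D (hat_kernel h ^~ s).
Proof.
apply: measurable_funTS; apply: measurable_funB; first exact: measurable_minr.
by apply: measurable_funM => //; exact: measurable_minr.
Qed.

Lemma measurable_hat_kernel_r (h t : R) (D : set R) :
  measurable_fun D (hat_kernel h t).
Proof.
apply: measurable_funTS; apply: measurable_funB; first exact: measurable_minr.
by apply: measurable_funM => //; exact: measurable_funM.
Qed.

(** At s = h, where [tau] is 0 by definition, the formula also gives 0, so it holds on the closed
    interval. *)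
Lemma tauE (k h s : R) : 0 < h -> s <= h ->
  tau k h s = s `^ (1 - k) - h `^ (- k) * s.
Proof.
move=> h0; rewrite le_eqVlt /tau => /predU1P[->|->//]; rewrite ltxx.
rewrite -[X in _ * X](powRr1 (ltW h0)) -powRD ?(gt_eqF h0) ?implybT//.
by have -> : - k + 1 = 1 - k; [ring | rewrite subrr].
Qed.

Lemma integral_hat_kernel (k h s : R) : 0 < k -> k < 1 -> 0 < h -> 0 <= s ->
  s <= h ->
  (\int[mu]_(t in `]0%R, +oo[) (hat_kernel h t s / t `^ (1 + k))%:E =
   (tau k h s / (k * (1 - k)))%:E)%E.
Proof.
move=> k0 k1 h0 s0 sh.
pose D : set R := `]0%R, +oo[%classic.
have mD : measurable D by exact: measurable_itv.
have Dgt0 t : D t -> 0 < t by rewrite /D/= in_itv/= andbT.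
pose F (u t : R) := Num.min u t / t `^ (1 + k).
have IF u : 0 <= u -> (\int[mu]_(t in D) (F u t)%:E = (u `^ (1 - k) / (k * (1 - k)))%:E)%E.
  exact: integral_min_powR.
have mF u : measurable_fun D (F u).
  by apply: measurable_div_powR; exact: measurable_minr.
have F0 u t : 0 <= u -> D t -> 0 <= F u t.
  by move=> u0 /Dgt0 t0; rewrite divr_ge0 ?powR_ge0// le_min u0 ltW.
have sh0 : 0 <= s / h by rewrite divr_ge0// ltW.
(* Written as a sum of nonnegative terms rather than as a difference, so that additivity holds
   before the kernel is known to be integrable. *)
have E : (\int[mu]_(t in D) (F s t)%:E =
  \int[mu]_(t in D) ((hat_kernel h t s / t `^ (1 + k))%:E + (s / h * F h t)%:E))%E.
  apply: eq_integral => t _; rewrite -EFinD; congr EFin.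
  by rewrite /F /hat_kernel mulrBl; ring.
move: E; rewrite ge0_integralD; last 5 first.
- exact: mD.
- move=> t /Dgt0 t0; rewrite lee_fin divr_ge0 ?powR_ge0//.
  by apply: hat_kernel_ge0 => //; exact: ltW.
- by apply/measurable_EFinP; apply: measurable_div_powR; exact: measurable_hat_kernel.
- by move=> t Dt; rewrite lee_fin mulr_ge0// F0// ltW.
- by apply/measurable_EFinP; apply: measurable_funM; [exact: measurable_cst|exact: mF].
rewrite ge0_integralZl_real; last 4 first.
- exact: mD.
- exact: mF.
- by move=> t Dt; apply: F0 => //; exact: ltW.
- exact: sh0.
rewrite (IF s s0) (IF h (ltW h0)) -EFinM.
(* The other two terms of the identity are finite, which rules out an infinite integral. *)
move: (\int[mu]_(t in D) _)%E => [r| |] //= [E]; congr EFin.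
have -> : r = s `^ (1 - k) / (k * (1 - k)) - s / h * (h `^ (1 - k) / (k * (1 - k))).
  by rewrite E addrK.
rewrite tauE//.
have -> : h `^ (- k) = h `^ (1 - k) / h.
  rewrite -[X in _ = _ / X](powRr1 (ltW h0)) -powRB ?(gt_eqF h0) ?implybT//.
  by congr powR; ring.
by field; rewrite !gt_eqF// subr_gt0.
Qed.

(** Up to a positive factor it is the integral of a nonnegative kernel. *)
Lemma tau_ge0 (k h s : R) : 0 < k -> k < 1 -> 0 < h -> 0 <= s -> s <= h ->
  0 <= tau k h s.
Proof.
move=> k0 k1 h0 s0 sh.
have kk0 : 0 < k * (1 - k) by rewrite mulr_gt0// subr_gt0.
have : (0 <= (tau k h s / (k * (1 - k)))%:E)%E.
  rewrite -(integral_hat_kernel k0 k1 h0 s0 sh).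
  apply: integral_ge0 => t; rewrite /= in_itv/= andbT => t0.
  rewrite lee_fin divr_ge0 ?powR_ge0//.
  by apply: hat_kernel_ge0 => //; exact: ltW.
by rewrite lee_fin pmulr_lge0// invr_gt0.
Qed.

Lemma measurable_tau (k h : R) (D : set R) : measurable_fun D (tau k h).
Proof.
apply: measurable_funTS; apply: measurable_fun_ifT => //.
- exact: measurable_fun_ltr.
- apply: measurable_funB; first exact: measurable_powR_in.
  exact: measurable_funM.
Qed.

End Marchaud_kernel.

(** * The bound at the point 0 *)

Section Marchaud_bound.
Context {R : realType}.
Local Notation mu := (@lebesgue_measure R).
Variables (phi psi v : R -> R) (M h : R).
Hypothesis h0 : 0 < h.
Hypothesis dphi : forall x, Rp x -> linear_approx Rp phi x (psi x).
Hypothesis AC : loc_abs_continuous psi.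
Hypothesis mv : measurable_fun `[0, h] v.
Hypothesis v0 : forall x, 0 <= v x.
Hypothesis psi_v : forall x y, 0 <= x -> x <= y -> y <= h ->
  (`|psi y - psi x|%:E <= \int[mu]_(s in `[x, y]) (v s)%:E)%E.
Hypothesis phiM : forall x, Rp x -> `|phi x| <= M.

Let H : set R := `[0, h]%classic.
Let mH : measurable H. Proof. exact: measurable_itv. Qed.
Let D : set R := `]0, +oo[%classic.
Let mD : measurable D. Proof. exact: measurable_itv. Qed.

Let M0 : 0 <= M.
Proof. by apply: le_trans (phiM (_ : Rp 0)); rewrite /Rp/= ?in_itv/= ?lexx. Qed.

Let phi2M x y : 0 <= x -> 0 <= y -> `|phi x - phi y| <= 2 * M.
Proof.
move=> x0 y0; apply: le_trans (ler_normB _ _) _.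
by rewrite mulr_natl mulr2n lerD// phiM// /Rp/= in_itv/= andbT.
Qed.

(** For t >= h the first term is already 2 M. For t < h, expand at t towards both 0 and h, and
    combine the two remainders so that the slope psi(t) disappears. *)
Lemma phi_increment_bound (t : R) : 0 < t ->
  (`|phi 0 - phi t|%:E <= (Num.min h t * (2 * M / h))%:E +
     \int[mu]_(s in H) (hat_kernel h t s * v s)%:E)%E.
Proof.
move=> t0.
have Kv0 s : H s -> (0 <= (hat_kernel h t s * v s)%:E)%E.
  rewrite /H/= in_itv/= => /andP[s0 sh]; rewrite lee_fin mulr_ge0//.
  by apply: hat_kernel_ge0 => //; exact: ltW.
have [ht|th] := leP h t.
  rewrite mulrC divfK ?gt_eqF//.
  apply: (@le_trans _ _ (2 * M)%:E); first by rewrite lee_fin phi2M// ltW.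
  by apply: leeDl; exact: integral_ge0.
have mvS (x y : R) : 0 <= x -> y <= h -> measurable_fun `[x, y] v.
  move=> x0 yh; apply: measurable_funS mv => //.
  by apply: subset_itvScc.
have TR : (`|phi t - phi 0 - psi t * (t - 0)|%:E <=
   \int[mu]_(s in `[0%R, t]) ((s - 0) * v s)%:E)%E.
  apply: Taylor_right => //; [by apply: AC; rewrite /Rp/= in_itv/= lexx| |].
    by apply: mvS => //; exact: ltW.
  by move=> x y x0 xy yt; apply: psi_v => //; lra.
have TL : (`|phi h - phi t - psi t * (h - t)|%:E <=
   \int[mu]_(s in `[t, h]) ((h - s) * v s)%:E)%E.
  apply: Taylor_left => //; [exact: ltW|by apply: AC; rewrite /Rp/= in_itv/= andbT ltW| |].
    by apply: mvS => //; exact: ltW.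
  by move=> x y x0 xy yt; apply: psi_v => //; lra.
set A := phi t - phi 0 - _ in TR.
set B := phi h - phi t - _ in TL.
have c1 : 0 <= 1 - t / h by rewrite subr_ge0 ler_pdivrMr// mul1r ltW.
have c2 : 0 <= t / h by rewrite divr_ge0 ?ltW.
(* The weights 1 - t / h and t / h are those for which psi(t) cancels; multiplied by s on [0, t] and
   by h - s on [t, h] they are the two branches of the kernel. *)
have E : phi 0 - phi t = t / h * (phi 0 - phi h) - (1 - t / h) * A + t / h * B.
  by rewrite /A /B; field; rewrite gt_eqF.
have split_int : (\int[mu]_(s in H) (hat_kernel h t s * v s)%:E =
   (1 - t / h)%:E * \int[mu]_(s in `[0%R, t]) ((s - 0) * v s)%:E +
   (t / h)%:E * \int[mu]_(s in `[t, h]) ((h - s) * v s)%:E)%E.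
  have mKv (S : set R) : S `<=` H -> measurable S ->
      measurable_fun S (fun s => (hat_kernel h t s * v s)%:E).
    move=> SH mS; apply/measurable_EFinP; apply: measurable_funM.
      exact: measurable_hat_kernel_r.
    exact: measurable_funS mv.
  have HE : H = `[0, t] `|` `]t, h].
    by rewrite /H -itv_bndbnd_setU//= bnd_simp// ltW.
  rewrite HE ge0_integral_setU//; last 3 first.
  - by rewrite -HE; exact: mKv.
  - by rewrite -HE.
  - rewrite disj_set2E; apply/eqP; rewrite -subset0 => x [] /=; rewrite !in_itv/=.
    by move=> /andP[_ xu] /andP[]; rewrite ltNge xu.
  rewrite integral_itv_obnd_cbnd; last first.
    by apply: mKv => //; rewrite HE; exact: subsetUr.
  congr (_ + _)%E.
  - rewrite -ge0_integralZl_real; last 4 first.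
    + exact: measurable_itv.
    + apply: measurable_funM; first exact: measurable_funB.
      by apply: mvS => //; exact: ltW.
    + by move=> x; rewrite /= in_itv/= subr0 => /andP[x0 _]; rewrite mulr_ge0.
    + exact: c1.
    apply: eq_integral => s; rewrite inE/= in_itv/= => /andP[s0 st].
    by rewrite hat_kernelE_le ?(ltW th)// subr0 mulrA.
  - rewrite -ge0_integralZl_real; last 4 first.
    + exact: measurable_itv.
    + apply: measurable_funM; first exact: measurable_funB.
      by apply: mvS => //; exact: ltW.
    + by move=> x; rewrite /= in_itv/= => /andP[_ x0]; rewrite mulr_ge0// subr_ge0.
    + exact: c2.
    apply: eq_integral => s; rewrite inE/= in_itv/= => /andP[s0 st].
    by rewrite hat_kernelE_ge ?(ltW th)// mulrA.
rewrite split_int.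
apply: (@le_trans _ _ ((t * (2 * M / h))%:E + ((1 - t / h)%:E * `|A|%:E + (t / h)%:E * `|B|%:E))%E).
  rewrite -!EFinM -!EFinD lee_fin E.
  apply: le_trans (ler_normD _ _) _; rewrite addrA; apply: lerD.
    apply: le_trans (ler_normB _ _) _; apply: lerD.
      have -> : t * (2 * M / h) = t / h * (2 * M) by ring.
      by rewrite normrM (ger0_norm c2) ler_wpM2l// phi2M// ltW.
    by rewrite normrM (ger0_norm c1).
  by rewrite normrM (ger0_norm c2).
by apply: leeD => //; apply: leeD; apply: lee_wpmul2l => //; rewrite lee_fin.
Qed.

Lemma Marchaud_integral_bound (k : R) : 0 < k -> k < 1 -> measurable_fun D phi ->
  ((k * (1 - k))%:E * \int[mu]_(t in D) (`|phi 0 - phi t| / t `^ (1 + k))%:E <=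
   (2 * M * h `^ (- k))%:E + \int[mu]_(s in H) (tau k h s * v s)%:E)%E.
Proof.
move=> k0 k1 mphi.
have kk0 : 0 < k * (1 - k) by rewrite mulr_gt0// subr_gt0.
have kkn : k * (1 - k) != 0 by rewrite gt_eqF.
have Dgt0 t : D t -> 0 < t by rewrite /D/= in_itv/= andbT.
pose F (t : R) := 2 * M / h * (Num.min h t / t `^ (1 + k)).
pose L (t s : R) := hat_kernel h t s / t `^ (1 + k) * v s.
have LE t s : L t s = hat_kernel h t s / t `^ (1 + k) * v s by [].
have FE t : F t = 2 * M / h * (Num.min h t / t `^ (1 + k)) by [].
have c0 : 0 <= 2 * M / h by rewrite divr_ge0 ?mulr_ge0// ltW.
have mmin : measurable_fun D (fun t => Num.min h t / t `^ (1 + k)).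
  by apply: measurable_div_powR; exact: measurable_minr.
have min0 t : D t -> 0 <= Num.min h t / t `^ (1 + k).
  by move=> /Dgt0 t0; rewrite divr_ge0 ?powR_ge0// le_min !ltW.
have F0 t : D t -> 0 <= F t by move=> Dt; rewrite FE mulr_ge0// min0.
have mF : measurable_fun D F by apply: measurable_funM; [exact: measurable_cst|exact: mmin].
have L0 t s : D t -> H s -> 0 <= L t s.
  move=> /Dgt0 t0; rewrite /H/= in_itv/= => /andP[s0 sh].
  rewrite LE mulr_ge0// divr_ge0 ?powR_ge0//; apply: hat_kernel_ge0 => //; exact: ltW.
have mL : measurable_fun (D `*` H) (fun z : R * R => (L z.1 z.2)%:E).
  apply/measurable_EFinP; apply: measurable_funM; last exact: measurable_fun_snd.
  under eq_fun do rewrite -powRN.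
  apply: measurable_funM; first exact: measurable_hat_kernel_pair.
  apply: (@measurable_fun_fst R D H (fun t => t `^ (- (1 + k)))) => //.
  exact: measurable_powR_in.
have mIL : measurable_fun D (fun t => \int[mu]_(s in H) (L t s)%:E)%E.
  by apply: measurable_integral_section => // t s Dt Hs; rewrite lee_fin L0.
have IL0 t : D t -> (0 <= \int[mu]_(s in H) (L t s)%:E)%E.
  by move=> Dt; apply: integral_ge0 => s Hs; rewrite lee_fin L0.
have step1 : (\int[mu]_(t in D) (`|phi 0 - phi t| / t `^ (1 + k))%:E <=
   \int[mu]_(t in D) ((F t)%:E + \int[mu]_(s in H) (L t s)%:E))%E.
  apply: ge0_le_integral.
  - exact: mD.
  - by move=> t /Dgt0 t0; rewrite lee_fin divr_ge0// powR_ge0.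
  - apply/measurable_EFinP; apply: measurable_div_powR.
    by apply: measurableT_comp => //; apply: measurable_funB.
  - by apply: emeasurable_funD; [exact/measurable_EFinP|exact: mIL].
  move=> t /Dgt0 t0.
  have c : 0 <= (t `^ (1 + k))^-1 by rewrite invr_ge0 powR_ge0.
  have mKv : measurable_fun H (fun s => hat_kernel h t s * v s).
    by apply: measurable_funM => //; exact: measurable_hat_kernel_r.
  have -> : (\int[mu]_(s in H) (L t s)%:E =
      (t `^ (1 + k))^-1%:E * \int[mu]_(s in H) (hat_kernel h t s * v s)%:E)%E.
    rewrite -ge0_integralZl_real; last 4 first.
    - exact: mH.
    - exact: mKv.
    - move=> s; rewrite /H/= in_itv/= => /andP[s0 sh]; apply: mulr_ge0 => //.
      by apply: hat_kernel_ge0 => //; exact: ltW.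
    - exact: c.
    by apply: eq_integral => s _; rewrite LE; congr EFin; ring.
  have -> : F t = (t `^ (1 + k))^-1 * (Num.min h t * (2 * M / h)).
    by rewrite FE; ring.
  rewrite mulrC !EFinM -muleDr//.
  by apply: lee_wpmul2l; [rewrite lee_fin|exact: phi_increment_bound].
have kkE : (0 <= (k * (1 - k))%:E)%E by rewrite lee_fin ltW.
apply: le_trans (lee_wpmul2l kkE step1) _.
rewrite ge0_integralD; last 5 first.
- exact: mD.
- by move=> t Dt; rewrite lee_fin F0.
- exact/measurable_EFinP.
- exact: IL0.
- exact: mIL.
rewrite (@ge0_tonelli_in R D H (fun t s => (L t s)%:E) mD mH mL L0).
have -> : (\int[mu]_(t in D) (F t)%:E =
  (2 * M / h)%:E * (h `^ (1 - k) / (k * (1 - k)))%:E)%E.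
  rewrite -(integral_min_powR k0 k1 (ltW h0)).
  exact: ge0_integralZl_real mD mmin min0 c0.
have tau0 s : H s -> 0 <= tau k h s.
  by rewrite /H/= in_itv/= => /andP[s0 sh]; exact: tau_ge0.
have mtau : measurable_fun H (tau k h) by exact: measurable_tau.
have -> : (\int[mu]_(s in H) \int[mu]_(t in D) (L t s)%:E =
  (k * (1 - k))^-1%:E * \int[mu]_(s in H) (tau k h s * v s)%:E)%E.
  rewrite -ge0_integralZl_real; last 4 first.
  - exact: mH.
  - exact: measurable_funM.
  - by move=> s Hs; rewrite mulr_ge0// tau0.
  - by rewrite invr_ge0 ltW.
  apply: eq_integral => s /set_mem Hs.
  have := Hs; rewrite /H/= in_itv/= => /andP[s0 sh].
  transitivity (\int[mu]_(t in D) (v s * (hat_kernel h t s / t `^ (1 + k)))%:E)%E.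
    by apply: eq_integral => t _; rewrite LE mulrC.
  rewrite ge0_integralZl_real; last 4 first.
  - exact: mD.
  - by apply: measurable_div_powR; exact: measurable_hat_kernel.
  - move=> t /Dgt0 t0; rewrite divr_ge0 ?powR_ge0//.
    by apply: hat_kernel_ge0 => //; exact: ltW.
  - exact: v0.
  rewrite (integral_hat_kernel k0 k1 h0 s0 sh) -EFinM; congr EFin.
  by field; rewrite !gt_eqF// subr_gt0.
rewrite ge0_muleDr; last 2 first.
- by rewrite -EFinM lee_fin mulr_ge0// divr_ge0 ?powR_ge0// ltW.
- apply: mule_ge0; first by rewrite lee_fin invr_ge0 ltW.
  apply: integral_ge0 => s Hs.
  by rewrite lee_fin mulr_ge0// tau0.
rewrite !muleA -!EFinM divff// mul1e leeD// lee_fin le_eqVlt; apply/orP; left; apply/eqP.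
have -> : h `^ (- k) = h `^ (1 - k) / h.
  rewrite -[X in _ = _ / X](powRr1 (ltW h0)) -powRB ?(gt_eqF h0) ?implybT//.
  by congr powR; ring.
by field; rewrite !gt_eqF// subr_gt0.
Qed.

End Marchaud_bound.

(** * Independence of the order of the difference *)

Section Marchaud_difference_order.
Context {R : realType}.
Local Notation mu := (@lebesgue_measure R).
Let D : set R := `]0%R, +oo[%classic.
Let mD : measurable D. Proof. exact: measurable_itv. Qed.

Lemma ge0_integral_dilation (m : R) (f : R -> \bar R) : 0 < m ->
  measurable_fun D f -> (forall x, D x -> (0 <= f x)%E) ->
  (\int[mu]_(t in D) f (m * t)%R = m^-1%:E * \int[mu]_(t in D) f t)%E.
Proof.
move=> m0 mf f0.
rewrite (ge0_integral_affine 0 m0 mD mf f0) muleA -EFinM mulVf ?gt_eqF// mul1e.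
apply: eq_integral_support => x; rewrite /D/= !in_itv/= !andbT addr0 ?pmulr_rgt0//.
Qed.

Lemma measurable_dilation (m : R) (f : R -> \bar R) : 0 < m ->
  measurable_fun D f -> measurable_fun D (fun t => f (m * t)%R).
Proof.
move=> m0 mf; apply: (measurable_comp mD _ mf).
  by move=> _ [t /= Dt <-]; move: Dt; rewrite /D/= !in_itv/= !andbT pmulr_rgt0.
exact: measurable_funM.
Qed.

Lemma integrable_dilation (m : R) (f : R -> \bar R) : 0 < m ->
  mu.-integrable D f -> mu.-integrable D (fun t => f (m * t)%R).
Proof.
move=> m0 /integrableP[mf fi]; apply/integrableP; split.
  exact: measurable_dilation.
have maf : measurable_fun D (abse \o f) by exact: measurableT_comp.
rewrite (@ge0_integral_dilation m (abse \o f) m0 maf) => [|x _]; last exact: abse_ge0.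
by rewrite lte_mul_pinfty// lee_fin invr_ge0 ltW.
Qed.

Lemma integral_dilation (m : R) (f : R -> \bar R) : 0 < m ->
  mu.-integrable D f ->
  (\int[mu]_(t in D) f (m * t)%R = m^-1%:E * \int[mu]_(t in D) f t)%E.
Proof.
move=> m0 fi; have [mf _] := integrableP _ _ _ fi.
have E := integralE mu D f.
have Em := integralE mu D (fun t => f (m * t)%R).
have P := ge0_integral_dilation m0 (measurable_funepos mf) (fun x _ => funepos_ge0 f x).
have N := ge0_integral_dilation m0 (measurable_funeneg mf) (fun x _ => funeneg_ge0 f x).
have fN : (\int[mu]_(t in D) f^\- t)%E \is a fin_num by exact: integrable_neg_fin_num.
transitivity (m^-1%:E * \int[mu]_(t in D) f^\+ t - m^-1%:E * \int[mu]_(t in D) f^\- t)%E.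
  by rewrite Em -P -N; congr (_ - _)%E; apply: eq_integral => t _; rewrite ?funeposE ?funenegE.
rewrite E; apply/esym/muleBr => //; apply: fin_num_adde_defl; rewrite fin_numN; exact: fN.
Qed.

Definition binomial_power_sum (k : R) (n : nat) : R :=
  \sum_(m < n.+1) (-1) ^+ m * 'C(n, m)%:R * (m%:R `^ k).

Lemma sum_alternating_binomial (n : nat) : (0 < n)%N ->
  \sum_(m < n.+1) (-1) ^+ m * 'C(n, m)%:R = 0 :> R.
Proof.
move=> n0; transitivity ((1 - 1 : R) ^+ n); last by rewrite subrr expr0n gtn_eqF.
rewrite exprBn; apply: eq_bigr => i _.
by rewrite !expr1n !mulr1 mulr_natr.
Qed.

(** The coefficients of the difference sum to 0, so f(x) can be subtracted from each value; each
    term is then a dilate by m of the integrand for n = 1. For m = 0 both sides contain f(x) -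
    f(x). *)
Lemma finite_diff_sum (k : R) (n : nat) (f : R -> R) (x t : R) :
  (0 < n)%N -> 0 < t ->
  finite_diff n f x t / t `^ (1 + k) =
  \sum_(m < n.+1) (- ((-1) ^+ m * 'C(n, m)%:R * (m%:R `^ (1 + k)))) *
    ((f x - f (x + m%:R * t)) / (m%:R * t) `^ (1 + k)).
Proof.
move=> n0 t0.
transitivity (\sum_(m < n.+1) ((-1) ^+ m * 'C(n, m)%:R * (f (x + m%:R * t) - f x)) / t `^ (1 + k)).
  rewrite -mulr_suml; congr (_ / _).
  under [in RHS]eq_bigr do rewrite mulrBr.
  by rewrite sumrB -mulr_suml sum_alternating_binomial// mul0r subr0.
apply: eq_bigr => -[[|m] /= mn] _.
  by rewrite mul0r addr0 subrr !mulr0 !mul0r mulr0.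
have tp : t `^ (1 + k) != 0 by rewrite gt_eqF ?powR_gt0.
have mp : m.+1%:R `^ (1 + k) != 0 :> R by rewrite gt_eqF ?powR_gt0.
rewrite powRM//; last exact: ltW.
by field; rewrite tp mp.
Qed.

(** Substituting m t for t costs a factor 1 / m, which turns the coefficient m^(1 + k) into m^k. *)
Lemma integral_finite_diff (k : R) (n : nat) (f : R -> R) (x : R) :
  0 < k -> (0 < n)%N ->
  mu.-integrable D (fun t => ((f x - f (x + t)) / t `^ (1 + k))%:E) ->
  (\int[mu]_(t in D) (finite_diff n f x t / t `^ (1 + k))%:E =
   (- binomial_power_sum k n)%:E *
   \int[mu]_(t in D) ((f x - f (x + t)) / t `^ (1 + k))%:E)%E.
Proof.
move=> k0 n0; set u := (fun t => _) => iu.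
pose c (m : 'I_n.+1) : R := - ((-1) ^+ m * 'C(n, m)%:R * (m%:R `^ (1 + k))).
transitivity (\int[mu]_(t in D) (\sum_(m < n.+1) (c m)%:E * u (m%:R * t)%R))%E.
  apply: eq_integral => t; rewrite inE /D/= in_itv/= andbT => t0.
  rewrite finite_diff_sum// -sumEFin; apply: eq_bigr => m _.
  by rewrite EFinM.
have ic (m : 'I_n.+1) : mu.-integrable D (fun t => (c m)%:E * u (m%:R * t)%R)%E.
  (* There is no dilation by 0, but the coefficient 0^(1 + k) is 0. *)
  case: (posnP m) => m0.
    have -> : c m = 0 by rewrite /c m0 powR0 ?mulr0 ?oppr0// gt_eqF// addr_gt0.
    by under eq_fun do rewrite mul0e; exact: integrable0.
  by apply: integrableZl => //; apply: integrable_dilation => //; rewrite ltr0n.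
rewrite integral_sum//.
have fI : (\int[mu]_(t in D) u t)%E \is a fin_num by exact: integrable_fin_num.
rewrite -[in RHS](fineK fI).
set r := fine _.
rewrite -EFinM -sumrN mulr_suml -sumEFin; apply: eq_bigr => m _.
case: (posnP m) => m0.
  rewrite /c m0 [in RHS]powR0 ?gt_eqF// mulr0 oppr0 mul0r.
  rewrite powR0 ?mulr0 ?oppr0; last by rewrite gt_eqF// addr_gt0.
  by apply: integral0_eq => t _; rewrite mul0e.
have mR : 0 < m%:R :> R by rewrite ltr0n.
rewrite integralZl//; last exact: integrable_dilation.
rewrite integral_dilation//.
rewrite -(fineK fI).
rewrite -/r -!EFinM; congr EFin; rewrite /c.
have -> : m%:R `^ (1 + k) = m%:R * m%:R `^ k :> R.
  by rewrite powRD ?(gt_eqF mR) ?implybT// powRr1// ltW.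
by field; rewrite gt_eqF.
Qed.

Lemma integrable_min_kernel (k c : R) (u : R -> R) : 0 < k -> k < 1 -> 0 <= c ->
  measurable_fun D u ->
  (forall t, D t -> `|u t| <= c * Num.min 1 t) ->
  mu.-integrable D (fun t => (u t / t `^ (1 + k))%:E).
Proof.
move=> k0 k1 c0 mfu uc; apply/integrableP; split.
  by apply/measurable_EFinP; exact: measurable_div_powR.
have mmin : measurable_fun D (fun t => Num.min 1 t / t `^ (1 + k)).
  by apply: measurable_div_powR; exact: measurable_minr.
have min0 t : D t -> 0 <= Num.min 1 t / t `^ (1 + k).
  by rewrite /D/= in_itv/= andbT => t0; rewrite divr_ge0 ?powR_ge0// le_min ler01 ltW.
apply: (@le_lt_trans _ _ (\int[mu]_(t in D) (c * (Num.min 1 t / t `^ (1 + k)))%:E)%E).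
  apply: ge0_le_integral.
  - exact: mD.
  - by move=> t _; exact: abse_ge0.
  - by apply: measurableT_comp => //; apply/measurable_EFinP; exact: measurable_div_powR.
  - by apply/measurable_EFinP; apply: measurable_funM => //; exact: measurable_cst.
  - move=> t Dt; rewrite lee_fin normrM (ger0_norm (_ : 0 <= (t `^ (1 + k))^-1)).
      by rewrite mulrA ler_wpM2r ?invr_ge0 ?powR_ge0// uc.
    by rewrite invr_ge0 powR_ge0.
rewrite (ge0_integralZl_real mD mmin min0 c0).
by rewrite (integral_min_powR k0 k1 ler01) -EFinM ltry.
Qed.

(* The sum is - \int_0^oo (1 - exp (- t))^n t^(- 1 - k) dt up to a positive
   factor. *)
Lemma binomial_power_sum_neq0 (k : R) (n : nat) : 0 < k -> k < 1 -> (0 < n)%N ->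
  binomial_power_sum k n != 0.
Proof.
move=> k0 k1 n0; apply/eqP => S0.
pose f (t : R) := expR (- t).
have mexp : measurable_fun setT f.
  by apply: (measurableT_comp (@measurable_expR R)).
have e1 t : 0 < t -> 0 < 1 - expR (- t).
  by move=> t0; rewrite subr_gt0 -expR0 ltr_expR oppr_lt0.
have iu : mu.-integrable D (fun t => ((f 0 - f (0 + t)) / t `^ (1 + k))%:E).
  apply: (@integrable_min_kernel k 1) => //.
    apply: measurable_funTS; apply: measurable_funB => //.
    by apply: (measurableT_comp mexp); exact: measurable_funD.
  move=> t; rewrite /D/= in_itv/= andbT => t0.
  rewrite add0r /f oppr0 expR0 mul1r ger0_norm; last exact/ltW/e1.
  rewrite le_min gerBl expR_ge0/= lerBlDr -lerBlDl.
  exact: expR_ge1Dx.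
have := integral_finite_diff k0 n0 iu; rewrite S0 oppr0 mul0e => I0.
have : (0 < \int[mu]_(t in D) (finite_diff n f 0 t / t `^ (1 + k))%:E)%E.
  (* By the binomial theorem the n-th difference of exp (- t) at 0 is an n-th power. Its weighted
     integral is positive, although by [I0] it would vanish along with the binomial sum. *)
  have fdE t : finite_diff n f 0 t = (1 - expR (- t)) ^+ n.
    rewrite exprBn /finite_diff; apply: eq_bigr => i _.
    by rewrite add0r /f expr1n mulr1 -expRM_natl mulrN -mulrnAl mulr_natr.
  apply: integral_gt0.
  - exact: mD.
  - by rewrite lebesgue_measure_itv/= ltry addye// lt0y.
  - apply: measurable_div_powR.
    rewrite (_ : finite_diff n f 0 = fun t => (1 - expR (- t)) ^+ n); last exact/funext.
    apply: measurable_funTS; apply: measurable_funX; apply: measurable_funB => //.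
  - move=> t; rewrite /D/= in_itv/= andbT => t0.
    by rewrite fdE divr_gt0 ?powR_gt0// exprn_gt0// e1.
by rewrite I0 ltxx.
Qed.

(** The binomial sum cancels against the one in [varkappa], leaving - 1 / Gamma (- k) = k (1 - k) /
    Gamma (2 - k). *)
Lemma MarchaudE (k : R) (n : nat) (f : R -> R) (x : R) :
  0 < k -> k < 1 -> (0 < n)%N ->
  mu.-integrable D (fun t => ((f x - f (x + t)) / t `^ (1 + k))%:E) ->
  Marchaud k n f x = ((k * (1 - k) / Gamma (2 - k))%:E *
    \int[mu]_(t in D) ((f x - f (x + t)) / t `^ (1 + k))%:E)%E.
Proof.
move=> k0 k1 n0 iu.
rewrite /Marchaud (integral_finite_diff k0 n0 iu) muleA -EFinM.
congr (_%:E * _)%E.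
rewrite /varkappa -/(binomial_power_sum k n).
have S0 := binomial_power_sum_neq0 k0 k1 n0.
have [G0 GE] := Gamma_spec k0 k1.
have kn0 : k != 0 by rewrite gt_eqF.
have k1n0 : 1 - k != 0 by rewrite subr_eq0 gt_eqF.
have Gn : Gamma (- k) != 0.
  by apply/eqP => E; move: G0; rewrite GE E mulr0 ltxx.
by rewrite GE; field; rewrite ?S0 ?Gn ?kn0 ?k1n0.
Qed.

End Marchaud_difference_order.

(** * The associated norm of tau *)

Section associated_norm.
Context {R : realType}.
Local Notation mu := (@lebesgue_measure R).
Variable E : idealLattice R.
Implicit Types f g : R -> R.

Lemma measurable_Rp : measurable (Rp : set R).
Proof. exact: measurable_itv. Qed.

Lemma RpE (x : R) : Rp x = (0 <= x) :> Prop.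
Proof. by rewrite /Rp/= in_itv/= andbT. Qed.

Lemma lat_norm0 : lat_norm E (fun=> 0) = 0.
Proof.
have := lat_normZ 0 (lat0 E); rewrite normr0 [RHS]mul0r => e.
by rewrite -[RHS]e; congr (lat_norm E _); apply/funext => x; rewrite mul0r.
Qed.

Lemma lat_norm_ge0 f : lat_set E f -> 0 <= lat_norm E f.
Proof.
move=> Ef; have := lat_normD Ef (latZ (-1) Ef).
rewrite lat_normZ// normrN1 mul1r.
rewrite (_ : (fun x => _) = (fun=> 0)); last by apply/funext => x; rewrite mulN1r subrr.
by rewrite lat_norm0 -mulr2n pmulrn_lge0.
Qed.

Lemma lat_abs f : lat_set E f ->
  lat_set E (fun x => `|f x|) /\ lat_norm E (fun x => `|f x|) <= lat_norm E f.
Proof.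
move=> Ef; apply: (lat_ideal Ef).
  by apply: measurableT_comp => //; exact: lat_measurable Ef.
by apply: aeW => x _; rewrite normr_id.
Qed.

Lemma assoc_norm_ge0 g : (0 <= assoc_norm E g)%E.
Proof.
apply: ereal_sup_ubound; exists (fun=> 0).
  by split; [exact: lat0|rewrite lat_norm0].
by apply: integral0_eq => x _; rewrite mul0r.
Qed.

(** Test the supremum on |f| / ||f||. If ||f|| = 0 this is impossible, and the right-hand side is 0
    even when the associated norm is infinite; then definiteness of the norm gives f = 0 a.e. *)
Lemma Holder_assoc f g : measurable_fun Rp g -> (forall x, Rp x -> 0 <= g x) ->
  lat_set E f ->
  (\int[mu]_(x in Rp) (`|f x| * g x)%:E <= assoc_norm E g * (lat_norm E f)%:E)%E.
Proof.
move=> mg g0 Ef; have [Eu uf] := lat_abs Ef.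
have mu_ := lat_measurable Eu.
have := lat_norm_ge0 Ef; rewrite le_eqVlt => /predU1P[n0|n0].
  have u0 : lat_norm E (fun x => `|f x|) = 0.
    by apply/le_anti; rewrite lat_norm_ge0// andbT n0.
  have := lat_eq0 Eu u0 => u00.
  rewrite -n0 mule0.
  rewrite (@ge0_ae_eq_integral _ _ _ mu Rp _ (fun=> 0%E)); first by rewrite integral0.
  - exact: measurable_Rp.
  - by apply/measurable_EFinP; exact: measurable_funM.
  - exact: measurable_cst.
  - by move=> x Rx; rewrite lee_fin mulr_ge0// g0.
  - by [].
  - apply: filterS u00; first exact: (ae_filter_ringOfSetsType mu).
    by move=> x /= h Rx; rewrite (h Rx) mul0r.
set n := lat_norm E f in n0 uf *.
have Ew : lat_set E (fun x => n^-1 * `|f x|) by exact: latZ.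
have nw : lat_norm E (fun x => n^-1 * `|f x|) <= 1.
  by rewrite lat_normZ// ger0_norm ?invr_ge0 ?(ltW n0)// mulrC ler_pdivrMr// mul1r.
have I : (\int[mu]_(x in Rp) (n^-1 * `|f x| * g x)%:E <= assoc_norm E g)%E.
  by apply: ereal_sup_ubound; exists (fun x => n^-1 * `|f x|).
have -> : (\int[mu]_(x in Rp) (`|f x| * g x)%:E =
    n%:E * \int[mu]_(x in Rp) (n^-1 * `|f x| * g x)%:E)%E.
  rewrite -ge0_integralZl_real; last 4 first.
  - exact: measurable_Rp.
  - by apply: measurable_funM => //; apply: measurable_funM.
  - by move=> x Rx; rewrite !mulr_ge0 ?g0// invr_ge0 ltW.
  - exact: ltW.
  by apply: eq_integral => x _; rewrite -mulrA mulVKf// gt_eqF.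
by rewrite muleC lee_wpmul2r// lee_fin ltW.
Qed.

End associated_norm.

(** * The associated norm of tau_h is finite and positive *)

Section assoc_norm_tau.
Context {R : realType}.
Local Notation mu := (@lebesgue_measure R).
Variables (E : idealLattice R) (k : R).
Hypotheses (k0 : 0 < k) (k1 : k < 1).
Hypothesis E_shift : semi_shift_invariant E.
Hypothesis E1_pow : assoc_space E (fun x : R => x `^ (1 - k) * \1_(`]0, 1[) x).

Lemma lat_power_bound1 : exists2 c : R, 0 <= c & forall f, lat_set E f ->
  (\int[mu]_(x in `]0%R, 1%R[) (`|f x| * x `^ (1 - k))%:E <= (c * lat_norm E f)%:E)%E.
Proof.
have [mg _ gfin] := E1_pow.
have g0 := assoc_norm_ge0 E (fun x : R => x `^ (1 - k) * \1_(`]0, 1[) x).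
exists (fine (assoc_norm E (fun x : R => x `^ (1 - k) * \1_(`]0, 1[) x))).
  exact: fine_ge0.
move=> f Ef; rewrite EFinM fineK; last by rewrite ge0_fin_numE.
apply: le_trans (Holder_assoc mg _ Ef); last by move=> x _; rewrite mulr_ge0 ?powR_ge0.
rewrite le_eqVlt; apply/orP; left; apply/eqP; apply: eq_integral_support => x.
- by move=> x01 _; rewrite indicE mem_set// mulr1.
- by rewrite RpE /= in_itv/= => /andP[/ltW ? _] /(_ _) [].
- by move=> _ x01; rewrite indicE memNset// !mulr0.
Qed.

(* A shift moves [a, a + 1/2[ onto [1/2, 1[, where x `^ (1 - k) is bounded from
   below. *)
Lemma lat_power_bound (n : nat) : exists2 c : R, 0 <= c & forall f, lat_set E f ->
  (\int[mu]_(x in `]0%R, (1 + n%:R / 2)%R[) (`|f x| * x `^ (1 - k))%:E <= (c * lat_norm E f)%:E)%E.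
Proof.
elim: n => [|n [c c0 IH]].
  have [c c0 h] := lat_power_bound1; exists c => // f Ef.
  by rewrite mul0r addr0; exact: h.
have [c1 c10 h1] := lat_power_bound1.
set a : R := 1 + n%:R / 2; pose b : R := 1 + n.+1%:R / 2.
have a1 : 1 <= a by rewrite lerDl divr_ge0.
have ab : b = a + 1 / 2 by rewrite /a /b -natr1; field.
(* On the new piece the weight is at most b^(1 - k), while (2 x)^(1 - k) >= 1 for x >= 1/2: C
   compares the weight before and after the shift. *)
pose C := b `^ (1 - k) * 2 `^ (1 - k).
have C0 : 0 <= C by rewrite mulr_ge0 ?powR_ge0.
exists (c + C * c1); first by rewrite addr_ge0// mulr_ge0.
move=> f Ef; rewrite -/b.
have mf := lat_measurable Ef.
have mfw (D : set R) : measurable D -> D `<=` Rp ->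
    measurable_fun D (fun x => `|f x| * x `^ (1 - k)).
  move=> mD DR; apply: measurable_funM; last exact: measurable_powR_in.
  by apply: measurableT_comp => //; exact: measurable_funS measurable_Rp DR mf.
have fw0 x : 0 <= `|f x| * x `^ (1 - k) by rewrite mulr_ge0 ?powR_ge0.
have split_b : `]0, b[%classic = `]0, a[ `|` `[a, b[ :> set R.
  by rewrite -itv_bndbnd_setU// bnd_simp; lra.
rewrite split_b ge0_integral_setU; last 5 first.
- exact: measurable_itv.
- exact: measurable_itv.
- rewrite -split_b; apply/measurable_EFinP; apply: mfw => // x.
  by rewrite RpE /= in_itv/= => /andP[/ltW].
- by move=> x _; rewrite lee_fin.
- rewrite disj_set2E; apply/eqP; rewrite -subset0 => x [] /=; rewrite !in_itv/=.
  by move=> /andP[_ xu] /andP[]; rewrite leNgt xu.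
rewrite mulrDl EFinD; apply: leeD; first exact: IH.
have Ra : Rp (a - 1 / 2) by rewrite RpE; lra.
have [Efa nfa] := E_shift Ef Ra.
set fa := (fun t => f (t + _)) in Efa nfa.
have mD : measurable (`[a, b[%classic : set R) by exact: measurable_itv.
have DR : `[a, b[%classic `<=` (Rp : set R).
  by move=> x; rewrite RpE /= in_itv/= => /andP[? _]; lra.
rewrite (ge0_integral_affine (a - 1 / 2) ltr01 mD); last 2 first.
- by apply/measurable_EFinP; exact: mfw.
- by move=> x _; rewrite lee_fin.
rewrite mul1e.
have mF : measurable_fun (`[a, b[%classic : set R) (fun x => (`|f x| * x `^ (1 - k))%:E).
  by apply/measurable_EFinP; exact: mfw.
have mfa : measurable_fun (`]0, 1[%classic : set R) (fun x => `|fa x| * x `^ (1 - k)).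
  apply: measurable_funM; last exact: measurable_powR_in.
  apply: measurableT_comp => //; apply: measurable_funS (lat_measurable Efa).
    exact: measurable_Rp.
  by move=> x; rewrite RpE /= in_itv/= => /andP[/ltW].
have mCfa (D : set R) : measurable D -> D `<=` `]0, 1[%classic ->
    measurable_fun D (fun x => (C * (`|fa x| * x `^ (1 - k)))%:E).
  move=> mD' DS; apply/measurable_EFinP; apply: measurable_funM; first exact: measurable_cst.
  by apply: measurable_funS mfa.
have sub01 : `[1 / 2, 1[%classic `<=` (`]0, 1[%classic : set R).
  by move=> x /=; rewrite !in_itv/= => /andP[x12 ->]; rewrite andbT; lra.
have SE : [set x : R | `[a, b[%classic (1 * x + (a - 1 / 2))] = `[1 / 2, 1[%classic.
  by apply/seteqP; split => x /=; rewrite !in_itv/= ab; lra.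
rewrite SE.
apply: (@le_trans _ _ (\int[mu]_(x in `]0%R, 1%R[) (C * (`|fa x| * x `^ (1 - k)))%:E)%E).
  apply: (@le_trans _ _ (\int[mu]_(x in `[(1 / 2)%R, 1%R[) (C * (`|fa x| * x `^ (1 - k)))%:E)%E).
    apply: ge0_le_integral.
    - exact: measurable_itv.
    - by move=> x _; rewrite lee_fin.
    - apply: (measurable_comp mD _ mF).
        by rewrite -SE => _ [x /= ? <-].
      by apply: measurable_funTS; exact: measurable_affine.
    - by apply: mCfa => //; exact: measurable_itv.
    move=> x; rewrite /= in_itv/= => /andP[x12 x1].
    have -> : fa x = f (x + (a - 1 / 2)) by [].
    rewrite [1 * x]mul1r lee_fin mulrCA ler_wpM2l// /C -mulrA.
    have xp : 0 <= x by lra.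
    rewrite -powRM// -[leLHS]mulr1; apply: ler_pM; rewrite ?powR_ge0//.
      have b0 : 0 <= b by rewrite ab; lra.
      have xa0 : 0 <= x + (a - 1 / 2) by lra.
      have xab : x + (a - 1 / 2) <= b by rewrite ab; lra.
      by apply: ge0_ler_powR; rewrite ?nnegrE// subr_ge0 ltW.
    have q0 : 0 <= 1 - k by rewrite subr_ge0 ltW.
    have := @ge0_ler_powR R (1 - k) q0 1 (2 * x); rewrite powR1; apply; rewrite ?nnegrE//; lra.
  apply: ge0_subset_integral => //.
  - by apply: mCfa.
  - by move=> x _; rewrite lee_fin !mulr_ge0 ?powR_ge0.
rewrite ge0_integralZl_real//; last first.
- by move=> x _; rewrite mulr_ge0 ?powR_ge0.
apply: (@le_trans _ _ (C%:E * (c1 * lat_norm E fa)%:E)%E).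
  by apply: lee_wpmul2l; [rewrite lee_fin|exact: h1].
by rewrite -EFinM lee_fin -mulrA ler_wpM2l// ler_wpM2l.
Qed.

(** On [0, h) one has 0 <= tau_h(x) <= x^(1 - k), so the weighted bound on an interval containing
    (0, h) applies. *)
Lemma assoc_norm_tau_fin (h : R) : 0 < h -> (assoc_norm E (tau k h) < +oo)%E.
Proof.
move=> h0.
(* Each step gains 1/2, so any number of steps n >= 2 h gives 1 + n / 2 >= h. *)
have [c c0 hc] := lat_power_bound (Num.truncn (h * 2)).+1.
set a := 1 + _ in hc.
have ha : h <= a.
  rewrite /a; have := truncnS_gt (h * 2) => hh.
  by rewrite -lerBlDl ler_pdivlMr//; apply: le_trans (ltW hh); lra.
apply: (@le_lt_trans _ _ c%:E); last exact: ltry.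
apply: ge_ereal_sup => _ [f [Ef f1] <-].
have mf := lat_measurable Ef.
have mft : measurable_fun Rp (fun x => f x * tau k h x).
  by apply: measurable_funM => //; exact: measurable_tau.
apply: (@le_trans _ _ (\int[mu]_(x in Rp) `|f x * tau k h x|%:E)%E).
  apply: le_trans (lee_abs _) _; apply: le_abse_integral => //.
    exact: measurable_Rp.
  exact/measurable_EFinP.
apply: (@le_trans _ _ (\int[mu]_(x in `]0%R, a[) (`|f x| * x `^ (1 - k))%:E)%E); last first.
  by apply: le_trans (hc f Ef) _; rewrite lee_fin -[leRHS]mulr1 ler_wpM2l.
rewrite (_ : \int[mu]_(x in Rp) _ = \int[mu]_(x in `]0%R, a[) `|f x * tau k h x|%:E)%E; last first.
  apply: eq_integral_support => x //=; rewrite in_itv/= ?RpE.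
  - move=> x0 /negP; rewrite negb_and -!leNgt => /orP[xle0|ax].
      have -> : x = 0 by apply/le_anti/andP.
      by rewrite /tau h0 powR0 ?subr_eq0 ?gt_eqF// mulr0 subrr mulr0 normr0.
    by rewrite /tau ltNge (le_trans ha ax) mulr0 normr0.
  - by move=> /andP[/ltW ? _] [].
apply: ge0_le_integral.
- exact: measurable_itv.
- by move=> x _; rewrite lee_fin.
- apply/measurable_EFinP; apply: measurableT_comp => //.
  apply: measurable_funS mft; first exact: measurable_Rp.
  by move=> x; rewrite RpE /= in_itv/= => /andP[/ltW].
- apply/measurable_EFinP; apply: measurable_funM; last exact: measurable_powR_in.
  apply: measurableT_comp => //; apply: measurable_funS mf; first exact: measurable_Rp.
  by move=> x; rewrite RpE /= in_itv/= => /andP[/ltW].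
- move=> x; rewrite /= in_itv/= => /andP[x0 _]; rewrite lee_fin normrM ler_wpM2l//.
  have [xh|hx] := ltP x h; last by rewrite /tau ltNge hx normr0 powR_ge0.
  rewrite ger0_norm; last by apply: tau_ge0 => //; exact: ltW.
  by rewrite /tau xh gerBl mulr_ge0 ?powR_ge0 ?ltW.
Qed.

(* Otherwise E vanishes near 0, hence its support is negligible near 0, whereas
   x `^ (1 - k) has to vanish off the support. *)
Lemma assoc_norm_tau_gt0 (h : R) : 0 < h -> (0 < assoc_norm E (tau k h))%E.
Proof.
move=> h0; rewrite lt0e assoc_norm_ge0 andbT; apply/eqP => t0.
have [mg [A [mA ARp EA Amin] gA] _] := E1_pow.
(* Below 1 the weight in [E1_pow] is positive, and below h so is tau_h. *)
pose d := Num.min 1 h.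
have d0 : 0 < d by rewrite lt_min ltr01.
have mtauf f : lat_set E f -> measurable_fun Rp (fun x => `|f x| * tau k h x).
  move=> Ef; apply: measurable_funM; last exact: measurable_tau.
  by apply: measurableT_comp => //; exact: lat_measurable Ef.
have tau_Rp x : Rp x -> 0 <= tau k h x.
  rewrite RpE => x0; have [xh|hx] := ltP x h; last by rewrite /tau ltNge hx.
  by apply: tau_ge0 => //; exact: ltW.
have tau_pos x : 0 < x -> x < h -> 0 < tau k h x.
  move=> x0 xh; rewrite /tau xh subr_gt0.
  have -> : x `^ (1 - k) = x * x `^ (- k).
    by rewrite powRD ?(gt_eqF x0) ?implybT// powRr1// ltW.
  rewrite mulrC ltr_pM2l// !powRN ltf_pV2 ?posrE ?powR_gt0//.
  by apply: gt0_ltr_powR; rewrite ?nnegrE// ltW.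
pose B : set R := Rp `\` `]0, d[%classic.
have mB : measurable B by apply: measurableD; [exact: measurable_Rp|exact: measurable_itv].
have EB f : lat_set E f -> vanishes_off B f.
  move=> Ef.
  have I0 : (\int[mu]_(x in Rp) (`|f x| * tau k h x)%:E = 0)%E.
    apply/le_anti/andP; split.
      have := Holder_assoc (@measurable_tau R k h Rp) tau_Rp Ef.
      by rewrite t0 mul0e.
    by apply: integral_ge0 => x Rx; rewrite lee_fin mulr_ge0// tau_Rp.
  have mEf : measurable_fun Rp (EFin \o (fun x => `|f x| * tau k h x)).
    by apply/measurable_EFinP; exact: mtauf.
  have : (\int[mu]_(x in Rp) `|(`|f x| * tau k h x)%:E| = 0)%E.
    by rewrite -I0; apply: eq_integral => x /set_mem Rx; rewrite /= ger0_norm// mulr_ge0// tau_Rp.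
  move=> /(ae_eq_integral_abs mu measurable_Rp mEf) H0.
  have : {ae mu, forall x, Rp x -> (`|f x| * tau k h x)%:E = 0%E} := H0.
  apply: filterS; first exact: (ae_filter_ringOfSetsType mu).
  move=> x /= H [Rx Bx].
  have : `]0, d[%classic x by apply: contrapT => nx; apply: Bx.
  rewrite /= in_itv/= lt_min => /and3P[x0 _ xh].
  have := H Rx => -[] /eqP; rewrite mulf_eq0 normr_eq0 => /orP[/eqP//|].
  by rewrite gt_eqF// tau_pos.
(* By minimality the support A has only a null part in (0, d). As the weight must vanish off A, the
   rest of (0, d) is null too. *)
have AB := Amin B mB EB.
have nA : mu.-negligible (`]0, d[%classic `\` A).
  move: gA; rewrite /vanishes_off => -[N [mN N0 sN]]; exists N; split => // x [/= xd nAx].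
  apply: sN => /= H; move: xd; rewrite in_itv/= lt_min => /and3P[x0 x1 _].
  have Rx : (Rp `\` A) x by split => //; rewrite RpE ltW.
  have := H Rx; rewrite indicE mem_set/= ?in_itv/= ?x0//.
  by rewrite mulr1 => /eqP; rewrite gt_eqF// powR_gt0.
have nd : mu.-negligible (`]0, d[%classic : set R).
  apply: negligibleS (negligibleU AB nA) => x xd.
  have [Ax|nAx] := pselect (A x); last by right; split.
  by left; split => // -[].
have : mu (`]0, d[%classic : set R) = 0%E by apply/negligibleP => //; exact: measurable_itv.
rewrite lebesgue_measure_itv/= lte_fin d0 => -[] /eqP.
by rewrite subr0 gt_eqF.
Qed.

End assoc_norm_tau.

(** * The inequality *)

Section Linf_norm_lemmas.
Context {R : realType}.
Local Notation mu := (@lebesgue_measure R).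

Lemma Linf_normP (F : R -> \bar R) (y : \bar R) : (0 <= y)%E ->
  (Linf_norm F <= y)%E <-> {ae mu, forall x, Rp x -> (`|F x| <= y)%E}.
Proof.
move=> y0; rewrite /Linf_norm unlock /Lnorm.
(* The norm is an essential supremum provided that the whole space has positive measure. *)
rewrite ifT; last first.
  apply: (@lt_le_trans _ _ (mu `[0%R, 1%R]%classic)).
    by rewrite lebesgue_measure_itv/= lte_fin ltr01 -EFinB lte_fin subr0.
  by apply: le_measure; rewrite ?inE.
have AF := ae_filter_ringOfSetsType mu.
split.
- move/ess_supP; apply: filterS => x /=; rewrite patchE => H Rx.
  by move: H; rewrite mem_set.
- move=> H; apply/ess_supP; move: H; apply: filterS => x /= H.
  rewrite patchE; case: ifPn => [/set_mem/H//|_].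
  by rewrite abse0.
Qed.

Lemma Linf_norm_ge0 (F : R -> \bar R) : (0 <= Linf_norm F)%E.
Proof. exact: Lnorm_ge0. Qed.

(** By continuity, |f x| > M would persist on an interval (x, x + d) of positive measure. The
    interval is taken on the right so that x = 0 is covered. *)
Lemma Linf_norm_bound (f f1 : R -> R) (M : R) :
  (forall x, Rp x -> linear_approx Rp f x (f1 x)) ->
  Linf_norm (EFin \o f) = M%:E -> forall x, Rp x -> `|f x| <= M.
Proof.
move=> df fM x Rx; rewrite leNgt; apply/negP => Mx.
have M0 : (0 <= M%:E)%E by rewrite -fM Linf_norm_ge0.
have : (Linf_norm (EFin \o f) <= M%:E)%E by rewrite fM.
move=> /(Linf_normP _ M0) [N [mN N0 sN]].
pose e := (`|f x| - M) / 2.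
have e0 : 0 < e by rewrite divr_gt0 ?subr_gt0.
have [d d0 Hd] := linear_approx_continuous e0 (df x Rx).
have x0 : 0 <= x by rewrite -RpE.
have sub : `]x, x + d[%classic `<=` N.
  move=> y /=; rewrite in_itv/= => /andP[xy yd]; apply: sN => /= H.
  have Ry : Rp y by rewrite RpE (le_trans x0 (ltW xy)).
  have := H Ry; rewrite lee_fin => fyM.
  have yx : `|y - x| < d.
    by rewrite ger0_norm ?ltrBlDl// subr_ge0 ltW.
  have := Hd y Ry yx => fyx.
  have : `|f x| <= `|f y| + `|f y - f x|.
    by rewrite -[X in `|X| <= _](subKr (f y)) ler_normB.
  rewrite /e in fyx e0; lra.
have : (mu (`]x, (x + d)%R[%classic : set R) <= mu N)%E.
  by apply: le_measure; rewrite ?inE.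
rewrite N0 lebesgue_measure_itv/= lte_fin ltrDl d0 -EFinB addrAC subrr add0r.
by rewrite lee_fin leNgt d0.
Qed.

End Linf_norm_lemmas.

(** * Transfer from the point 0 to every x, by translation *)

Section upper_bound.
Context {R : realType}.
Local Notation mu := (@lebesgue_measure R).
Variables (E : idealLattice R) (k h : R) (n : nat).
Hypotheses (k0 : 0 < k) (k1 : k < 1) (n0 : (0 < n)%N) (h0 : 0 < h).
Hypothesis E_shift : semi_shift_invariant E.

Let D : set R := `]0%R, +oo[%classic.

Lemma ae_linear_approx_shift (f1 f2 : R -> R) (x : R) : Rp x ->
  {ae mu, forall y, Rp y -> has_deriv f1 y (f2 y)} ->
  {ae mu, forall y, Rp y ->
    linear_approx Rp (fun t => f1 (t + x)) y (f2 (y + x))}.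
Proof.
move=> Rx H.
have := @negligible_affine R 1 x _ ltr01 H.
apply: negligibleS => y /= nH Hy; apply: nH => Ry.
have := Hy; rewrite mul1r => {}Hy.
apply: linear_approx_shift => //; apply/has_derivP; apply: Hy.
by move: Ry Rx; rewrite !RpE; exact: addr_ge0.
Qed.

Lemma loc_abs_continuous_shift (g : R -> R) (x : R) : Rp x ->
  loc_abs_continuous g -> loc_abs_continuous (fun t => g (t + x)).
Proof.
move=> Rx H a b Ra e e0.
have Rax : Rp (a + x) by move: Ra Rx; rewrite !RpE; exact: addr_ge0.
have [d d0 Hd] := H (a + x) (b + x) Rax e e0.
exists d => // m u v uv tI s.
have := Hd m (fun i => u i + x) (fun i => v i + x); apply.
- by move=> i; have [? ? ?] := uv i; rewrite !lerD2r.
- apply/trivIsetP => i j _ _ ij; rewrite -subset0 => z [] /=; rewrite !in_itv/= => zi zj.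
  have /trivIsetP/(_ i j I I ij) := tI; rewrite -subset0 => /(_ (z - x)); apply.
  by split; rewrite /= in_itv/=; lra.
- by under eq_bigr do rewrite opprD addrACA subrr addr0.
Qed.

(** The bound at 0 is applied to f(. + x); the Hölder inequality in E is applied to f''(. + x),
    whose norm is at most that of f''. *)
Lemma Marchaud_pointwise_bound (f f2 : R -> R) (M T x : R) :
  second_derivative f f2 -> measurable_fun Rp f -> lat_set E f2 ->
  (forall y, Rp y -> `|f y| <= M) ->
  assoc_norm E (tau k h) = T%:E -> Rp x ->
  (`|Marchaud k n f x| <=
   ((2 * M * h `^ (- k) + T * lat_norm E f2) / Gamma (2 - k))%:E)%E.
Proof.
move=> [f1 [df1 ACf1 df2]] mf Ef2 fM ET Rx.
have x0 : 0 <= x by rewrite -RpE.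
have [Ev nv] := E_shift Ef2 Rx.
have mv := lat_measurable Ev.
pose v t := `|f2 (t + x)|.
have H_Rp : `[0, h]%classic `<=` (Rp : set R).
  by move=> y; rewrite RpE /= in_itv/= => /andP[].
have D_Rp : D `<=` (Rp : set R).
  by move=> y; rewrite RpE /D/= in_itv/= andbT => /ltW.
have ACpsi := loc_abs_continuous_shift Rx ACf1.
have mphi : measurable_fun D (fun t => f (t + x)).
  apply: (measurable_comp measurable_Rp _ mf).
    move=> _ [t /= /D_Rp Dt <-]; move: Dt; rewrite !RpE => t0; exact: addr_ge0.
  exact: measurable_funD.
have psi_v : forall a b : R, 0 <= a -> a <= b -> b <= h ->
    (`|f1 (b + x) - f1 (a + x)|%:E <= \int[mu]_(s in `[a, b]) (v s)%:E)%E.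
  move=> a b a0 ab bh.
  have ab_Rp : `[a, b]%classic `<=` (Rp : set R).
    by move=> y; rewrite RpE /= in_itv/= => /andP[/(le_trans a0)].
  apply: (@abs_continuous_le_integral _ a b (fun t => f1 (t + x)) (fun t => f2 (t + x))) => //.
  - by apply: ACpsi; rewrite RpE.
  - exact: measurable_funS measurable_Rp ab_Rp mv.
  - have := ae_linear_approx_shift Rx df2.
    apply: filterS; first exact: (ae_filter_ringOfSetsType mu).
    move=> y Hy /andP[ay yb]; apply: linear_approxS (Hy _) => //.
    by rewrite RpE (le_trans a0).
have T_ge0 : 0 <= T by rewrite -lee_fin -ET assoc_norm_ge0.
have tau_Rp y : Rp y -> 0 <= tau k h y.
  rewrite RpE => y0; have [yh|hy] := ltP y h; last by rewrite /tau ltNge hy.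
  by apply: tau_ge0 => //; exact: ltW.
have Itau : (\int[mu]_(s in `[0%R, h]) (tau k h s * v s)%:E <= (T * lat_norm E f2)%:E)%E.
  have H1 := Holder_assoc (@measurable_tau R k h Rp) tau_Rp Ev.
  rewrite ET -EFinM in H1.
  apply: (@le_trans _ _ (T * lat_norm E (fun t => f2 (t + x)))%:E); last first.
    by rewrite lee_fin ler_wpM2l.
  apply: le_trans H1.
  apply: (@le_trans _ _ (\int[mu]_(s in Rp) (tau k h s * v s)%:E)%E); last first.
    rewrite le_eqVlt; apply/orP; left; apply/eqP.
    by apply: eq_integral => s _; rewrite mulrC.
  apply: ge0_subset_integral => //.
  - exact: measurable_Rp.
  - apply/measurable_EFinP; apply: measurable_funM; first exact: measurable_tau.
    by apply: measurableT_comp.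
  - move=> s Rs; rewrite lee_fin; apply: mulr_ge0; [exact: tau_Rp|exact: normr_ge0].
have B : ((k * (1 - k))%:E *
    \int[mu]_(t in D) (`|f (0 + x) - f (t + x)| / t `^ (1 + k))%:E <=
    (2 * M * h `^ (- k))%:E + \int[mu]_(s in `[0%R, h]) (tau k h s * v s)%:E)%E.
  apply: (@Marchaud_integral_bound R (fun t => f (t + x)) (fun t => f1 (t + x)) v M h) => //.
  - move=> y Ry; apply: linear_approx_shift => //; apply/has_derivP; apply: df1.
    by move: Ry Rx; rewrite !RpE; exact: addr_ge0.
  - apply: measurable_funS measurable_Rp H_Rp _.
    by apply: measurableT_comp.
  - by move=> s; exact: normr_ge0.
  - by move=> y; rewrite RpE => y0; apply: fM; rewrite RpE addr_ge0.
have {B Itau} B := le_trans B (leeD2l _ Itau).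
rewrite -EFinD add0r in B.
have kk0 : 0 < k * (1 - k) by rewrite mulr_gt0// subr_gt0.
set I := (\int[mu]_(t in D) _)%E in B.
have I0 : (0 <= I)%E.
  by apply: integral_ge0 => t _; rewrite lee_fin divr_ge0// powR_ge0.
(* The bound yields absolute convergence, which is what permits rewriting D^k f by its n = 1
   form. *)
have Ifin : (I < +oo)%E.
  move: B I0; case: I => [r _ _| |//]; first exact: ltry.
  by rewrite gt0_muley ?lte_fin// leye_eq.
have mD : measurable D by exact: measurable_itv.
have mu_ : measurable_fun D (fun t => (f x - f (x + t)) / t `^ (1 + k)).
  apply: measurable_div_powR; apply: measurable_funB => //.
  by rewrite (_ : (fun t => f (x + t)) = (fun t => f (t + x))) //; apply/funext => t; rewrite addrC.
have absE : (\int[mu]_(t in D) `|((f x - f (x + t)) / t `^ (1 + k))%:E| = I)%E.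
  apply: eq_integral => t _.
  by rewrite /= normrM [x + t]addrC [X in _ * X]ger0_norm// invr_ge0 powR_ge0.
have iu : mu.-integrable D (fun t => ((f x - f (x + t)) / t `^ (1 + k))%:E).
  by apply/integrableP; split; [exact/measurable_EFinP | rewrite absE].
have [G0 _] := Gamma_spec k0 k1.
rewrite (MarchaudE k0 k1 n0 iu) abseM /= ger0_norm; last first.
  by rewrite divr_ge0 ?(ltW kk0)// ltW.
apply: (@le_trans _ _ ((k * (1 - k) / Gamma (2 - k))%:E * I)%E).
  apply: lee_wpmul2l; first by rewrite lee_fin divr_ge0 ?(ltW kk0)// ltW.
  rewrite -absE; apply: le_abse_integral => //.
  exact/measurable_EFinP.
rewrite [k * (1 - k) / _]mulrC EFinM -muleA [_ / Gamma _]mulrC [in leRHS]EFinM.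
by apply: lee_wpmul2l => //; rewrite lee_fin invr_ge0 ltW.
Qed.

Lemma Marchaud_upper_bound (f f2 : R -> R) :
  (assoc_norm E (tau k h) < +oo)%E -> L2infE E f f2 ->
  (Linf_norm (Marchaud k n f) <=
    (2 * h `^ (- k) / Gamma (2 - k))%:E * Linf_norm (EFin \o f) +
    assoc_norm E (tau k h) * ((Gamma (2 - k))^-1)%:E * (lat_norm E f2)%:E)%E.
Proof.
move=> Tfin [[mf ffin] sd Ef2].
have /fineK TE : assoc_norm E (tau k h) \is a fin_num by rewrite ge0_fin_numE// assoc_norm_ge0.
have /fineK ME : Linf_norm (EFin \o f) \is a fin_num by rewrite ge0_fin_numE// Linf_norm_ge0.
set T := fine _ in TE; set M := fine _ in ME.
have [G0 _] := Gamma_spec k0 k1.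
have M0 : 0 <= M by rewrite -lee_fin ME Linf_norm_ge0.
have T_ge0 : 0 <= T by rewrite -lee_fin TE assoc_norm_ge0.
rewrite -TE -ME -!EFinM -EFinD.
have -> : 2 * h `^ (- k) / Gamma (2 - k) * M + T / Gamma (2 - k) * lat_norm E f2 =
  (2 * M * h `^ (- k) + T * lat_norm E f2) / Gamma (2 - k).
  by field; rewrite gt_eqF.
apply/Linf_normP.
  rewrite lee_fin divr_ge0 ?(ltW G0)// addr_ge0 ?mulr_ge0 ?powR_ge0//.
  exact: lat_norm_ge0.
have fM x : Rp x -> `|f x| <= M.
  have [f1 [df1 _ _]] := sd.
  apply: (@Linf_norm_bound R f f1) => //.
  by move=> y Ry; apply/has_derivP; exact: df1.
by apply: aeW => x Rx; apply: Marchaud_pointwise_bound.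
Qed.

End upper_bound.

(** * Sharpness *)

Section extremal_function.
Context {R : realType}.
Local Notation mu := (@lebesgue_measure R).
Variables (g : R -> R) (N h : R).
Hypotheses (h0 : 0 < h) (mg : measurable_fun setT g).
Hypothesis g0 : forall x, 0 <= g x.
Hypothesis gN : forall x, g x <= N.
Hypothesis gH : forall x, ~ `[0, h]%classic x -> g x = 0.

Let H : set R := `[0, h]%classic.
Let mH : measurable H. Proof. exact: measurable_itv. Qed.

Let N0 : 0 <= N. Proof. exact: le_trans (g0 0) (gN 0). Qed.

Lemma bounded_integrable_weight (q : R -> R) (c : R) : measurable_fun H q ->
  (forall s, H s -> `|q s| <= c) -> mu.-integrable H (EFin \o (fun s => q s * g s)).
Proof.
move=> mq qc; have mgH : measurable_fun H g by exact: measurable_funTS.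
apply/integrableP; split.
  by apply/measurable_EFinP; exact: measurable_funM.
apply: (@le_lt_trans _ _ (\int[mu]_(s in H) (c * N)%:E)%E).
  apply: ge0_le_integral => //.
  - apply: measurableT_comp => //.
    by apply/measurable_EFinP; exact: measurable_funM.
  - move=> s Hs; rewrite lee_fin normrM (ger0_norm (g0 s)).
    by apply: ler_pM => //; exact: qc.
rewrite integral_cst// /= lebesgue_measure_itv/= lte_fin h0 -EFinB -EFinM.
exact: ltry.
Qed.

Lemma integrable_g : mu.-integrable setT (EFin \o g).
Proof.
have i1 : mu.-integrable H (EFin \o (fun s => 1 * g s)).
  by apply: (@bounded_integrable_weight (fun=> 1) 1) => // s _; rewrite normr1.
have /integrableP[_ fi] := i1.
apply/integrableP; split; first exact/measurable_EFinP.
apply: le_lt_trans fi; rewrite le_eqVlt; apply/orP; left; apply/eqP.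
apply: eq_integral_support => x // _.
- by rewrite /= mul1r.
- by move=> Hx; rewrite /= gH// normr0.
- by move=> /(_ I) [].
Qed.

Definition moment := \int[mu]_(s in H) (s * g s).
(** The factor 1 gives it the same shape, weight times g, as the other integrals. *)
Definition mass := \int[mu]_(s in H) (1 * g s).

(* The convex decreasing function with second derivative g, constant after h;
   the constant is such that its values at 0 and h are opposite. *)
Definition extremal (y : R) :=
  (\int[mu]_(s in H) (Num.max (s - y) 0 * g s)) - moment / 2.
(** Minus the integral of g beyond y, written through a primitive from - oo so that Lebesgue
    differentiation and absolute continuity of the integral apply directly. *)
Definition extremal' (y : R) :=
  (\int[mu]_(t in `]-oo, y]) g t) - \int[mu]_t g t.

Lemma measurable_maxB y (D : set R) : measurable_fun D (fun s : R => Num.max (s - y) 0).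
Proof. by apply: measurable_maxr => //; exact: measurable_funB. Qed.

Lemma integrable_maxB y : mu.-integrable H (EFin \o (fun s => Num.max (s - y) 0 * g s)).
Proof.
apply: (@bounded_integrable_weight _ (`|h| + `|y|)); first exact: measurable_maxB.
move=> s; rewrite /H/= in_itv/= => /andP[s0 sh].
rewrite ger0_norm ?le_max ?lexx ?orbT// ge_max addr_ge0// andbT.
have := ler_norm h; have := ler_norm (- y); rewrite normrN; lra.
Qed.

Lemma integrable_step y :
  mu.-integrable H (EFin \o (fun s => (if y < s then 1 else 0) * g s)).
Proof.
apply: (@bounded_integrable_weight _ 1).
  by apply: measurable_funTS; apply: measurable_fun_ifT => //; exact: measurable_fun_ltr.
by move=> s _; case: ifP; rewrite ?normr1// normr0.
Qed.

Lemma extremal'E y :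
  extremal' y = - \int[mu]_(s in H) ((if y < s then 1 else 0) * g s).
Proof.
rewrite /extremal' -(setUv `]-oo, y]%classic) setCitvl Rintegral_setU//; last 2 first.
- by rewrite -setCitvl setUv; exact: integrable_g.
- by rewrite -setCitvl; apply/disj_setPCl.
rewrite opprD addrA subrr add0r; congr (- fine _).
apply: eq_integral_support => x.
- by rewrite /= in_itv/= andbT => -> _; rewrite mul1r.
- by move=> _ Hx; rewrite gH.
- by move=> _ /=; rewrite in_itv/= andbT => /negP/negbTE ->; rewrite mul0r.
Qed.

(** For fixed s, the remainder of y -> max(s - y, 0) is zero unless s lies between y and z, and is
    at most |z - y| there. Integrating against g <= N gives the square; this is where boundedness of
    g enters. *)
Lemma extremal_taylor y z :
  `|extremal z - extremal y - extremal' y * (z - y)| <= N * `|z - y| ^+ 2.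
Proof.
rewrite extremal'E /extremal.
pose q s := Num.max (s - z) 0 - Num.max (s - y) 0 + (z - y) * (if y < s then 1 else 0).
have qE s : q s = Num.max (s - z) 0 - Num.max (s - y) 0 + (z - y) * (if y < s then 1 else 0) by [].
pose J : set R := `[Num.min y z, Num.max y z]%classic.
have qJ s : ~ J s -> q s = 0.
  rewrite /J/= in_itv/= => /negP; rewrite negb_and -!ltNge lt_min gt_max qE.
  move=> /orP[/andP[sy sz]|/andP[ys zs]].
    by rewrite ltNge (ltW sy)/= !max_r ?subr_le0 ?(ltW sy) ?(ltW sz)// subrr mulr0 addr0.
  by rewrite ys !max_l ?subr_ge0 ?(ltW ys) ?(ltW zs)//; ring.
have qb s : `|q s| <= `|z - y|.
  rewrite qE ler_norml; have := ler_norm (z - y); have := ler_norm (- (z - y)).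
  rewrite normrN => H1 H2.
  case: (ltP y s) => ys; case: (leP z s) => zs;
  [rewrite !max_l|rewrite max_r ?max_l|rewrite max_l ?max_r|rewrite !max_r]; try lra.
have mq D : measurable_fun D q.
  apply: measurable_funTS; apply: measurable_funD.
    by apply: measurable_funB; exact: measurable_maxB.
  apply: measurable_funM => //; apply: measurable_fun_ifT => //; exact: measurable_fun_ltr.
have iq : mu.-integrable H (EFin \o (fun s => q s * g s)).
  by apply: (@bounded_integrable_weight _ `|z - y|).
have -> : (\int[mu]_(s in H) (Num.max (s - z) 0 * g s)) - moment / 2 -
   ((\int[mu]_(s in H) (Num.max (s - y) 0 * g s)) - moment / 2) -
   - (\int[mu]_(s in H) ((if y < s then 1 else 0) * g s)) * (z - y) =
   \int[mu]_(s in H) (q s * g s).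
  have i1 := integrable_maxB z; have i2 := integrable_maxB y; have i3 := integrable_step y.
  have i3' : mu.-integrable H (EFin \o (fun s => (z - y) * ((if y < s then 1 else 0) * g s))).
    under [X in integrable _ _ X]eq_fun do rewrite /= EFinM.
    exact: integrableZl.
  have i12 : mu.-integrable H
      (EFin \o (fun s => Num.max (s - z) 0 * g s - Num.max (s - y) 0 * g s)).
    under [X in integrable _ _ X]eq_fun do rewrite /= EFinB.
    exact: integrableB.
  have e3 : \int[mu]_(s in H) ((z - y) * ((if y < s then 1 else 0) * g s)) =
    (z - y) * \int[mu]_(s in H) ((if y < s then 1 else 0) * g s).
    by rewrite RintegralZl.
  transitivity ((\int[mu]_(s in H) (Num.max (s - z) 0 * g s - Num.max (s - y) 0 * g s)) +
    \int[mu]_(s in H) ((z - y) * ((if y < s then 1 else 0) * g s))).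
    by rewrite RintegralB// e3; ring.
  rewrite -RintegralD//; apply: eq_Rintegral => s _.
  by rewrite qE; ring.
apply: le_trans (le_normr_Rintegral _ iq) _; first exact: mH.
have JE : mu J = `|z - y|%:E.
  rewrite /J lebesgue_measure_itv/= lte_fin.
  case: (leP y z) => yz.
    rewrite ger0_norm ?subr_ge0//; move: yz; rewrite le_eqVlt => /predU1P[->|->//].
    by rewrite ltxx subrr.
  by rewrite yz ltr0_norm ?subr_lt0// opprB.
have IJ : (\int[mu]_(s in J) (N * `|z - y|)%:E = (N * `|z - y| ^+ 2)%:E)%E.
  have -> : (N * `|z - y| ^+ 2)%:E = ((N * `|z - y|)%:E * mu J)%E.
    by rewrite JE -EFinM expr2 mulrA.
  by rewrite integral_cst//; exact: measurable_itv.
rewrite /Rintegral -lee_fin fineK; last first.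
  apply: integrable_fin_num => //.
  exact: integrable_abse iq.
rewrite -IJ.
rewrite (_ : (\int[mu]_(s in H) `|q s * g s|%:E) =
  (\int[mu]_(s in H `&` J) `|q s * g s|%:E))%E; last first.
  apply: eq_integral_support => s //.
  - by move=> Hs HJ; rewrite qJ ?mul0r ?normr0// => Js; apply: HJ.
  - by move=> [Hs _] /(_ Hs) [].
have mJ : measurable J by exact: measurable_itv.
have mqg (D : set R) : measurable_fun D (fun s => `|q s * g s|%:E).
  apply/measurable_EFinP; apply: measurableT_comp => //; apply: measurable_funM => //.
  exact: measurable_funTS.
apply: (@le_trans _ _ (\int[mu]_(s in J) `|q s * g s|%:E)%E).
  apply: ge0_subset_integral; [exact: measurableI|exact: mJ|exact: mqg|by []|].
  by move=> s [].
apply: ge0_le_integral; [exact: mJ|by []|exact: mqg|exact: measurable_cst|].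
by move=> s _; rewrite lee_fin normrM (ger0_norm (g0 s)) mulrC ler_pM.
Qed.

Lemma extremal_linear_approx (D : set R) y :
  linear_approx D extremal y (extremal' y).
Proof.
move=> e e0; have N1 : 0 < N + 1 by rewrite ltr_wpDl.
exists (e / (N + 1)); first by rewrite divr_gt0.
move=> z _; rewrite ltr_pdivlMr// => zy.
apply: le_trans (extremal_taylor y z) _.
rewrite expr2 mulrA ler_wpM2r//.
apply: le_trans (ltW zy); rewrite mulrC ler_wpM2l// lerDl.
exact: ler01.
Qed.

Lemma continuous_extremal : continuous extremal.
Proof.
move=> y; apply: differentiable_continuous; apply/derivable1_diffP.
have : is_derive y 1 extremal (extremal' y).
  by apply: (@linear_approx_is_derive _ setT _ _ _ 1) => //; exact: extremal_linear_approx.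
by case.
Qed.

Lemma measurable_extremal (D : set R) : measurable_fun D extremal.
Proof.
apply: measurable_funTS; apply: continuous_measurable_fun.
exact: continuous_extremal.
Qed.

Lemma integrable_id_g : mu.-integrable H (EFin \o (fun s => s * g s)).
Proof.
apply: (@bounded_integrable_weight _ h) => // s; rewrite /H/= in_itv/= => /andP[s0 sh].
by rewrite ger0_norm.
Qed.

Lemma moment_ge0 : 0 <= moment.
Proof.
by apply: Rintegral_ge0 => s; rewrite /H/= in_itv/= => /andP[s0 _]; rewrite mulr_ge0.
Qed.

Lemma mass_ge0 : 0 <= mass.
Proof. by apply: Rintegral_ge0 => s _; rewrite mul1r. Qed.

Lemma extremal_bound y : Rp y -> `|extremal y| <= moment / 2.
Proof.
rewrite RpE => y0; rewrite /extremal.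
have I0 : 0 <= \int[mu]_(s in H) (Num.max (s - y) 0 * g s).
  by apply: Rintegral_ge0 => s _; rewrite mulr_ge0// le_max lexx orbT.
have I1 : \int[mu]_(s in H) (Num.max (s - y) 0 * g s) <= moment.
  apply: le_Rintegral; [exact: mH|exact: integrable_maxB|exact: integrable_id_g|].
  move=> s; rewrite /H/= in_itv/= => /andP[s0 _]; rewrite ler_wpM2r// ge_max s0 andbT.
  by rewrite gerBl.
move: (Rintegral _ _ _) moment I0 I1 => r m r0 rm.
by rewrite ler_norml; lra.
Qed.

Lemma Linf_extremal : Linf extremal /\ (Linf_norm (EFin \o extremal) <= (moment / 2)%:E)%E.
Proof.
have b : (Linf_norm (EFin \o extremal) <= (moment / 2)%:E)%E.
  apply/Linf_normP; first by rewrite lee_fin divr_ge0// moment_ge0.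
  by apply: aeW => x Rx; rewrite lee_fin extremal_bound.
split => //; split; first exact: measurable_extremal.
by apply: le_lt_trans b _; exact: ltry.
Qed.

Lemma extremal_second_derivative : second_derivative extremal g.
Proof.
exists extremal'; split.
- by move=> x _; apply/has_derivP; exact: extremal_linear_approx.
- move=> a b _ e e0.
  have [d d0 Hd] := abs_continuous_integral a b integrable_g e0.
  exists d => // m u v uv tI sd.
  under eq_bigr do rewrite opprB addrA subrK.
  exact: Hd.
- pose P (y : R) := \int[mu]_(t in `]-oo, y]) g t.
  have : {ae mu, forall x, derivable P x 1 /\ P^`()%classic x = g x}.
    apply: FTC1Ny; first by move=> y; exact: integrableS integrable_g.
    by apply: open_integrable_locally; [exact: openT|exact: integrable_g].
  apply: filterS; first exact: (ae_filter_ringOfSetsType mu).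
  move=> x [dx gx] Rx; apply/has_derivP => e e0.
  have [d d0 Hd] := is_derive_linear_approx Rp (DeriveDef dx erefl) e0.
  exists d => // y Ry yx; have := Hd y Ry yx.
  by rewrite -derive1E gx /extremal' opprB addrA subrK.
Qed.

End extremal_function.

(** * The Marchaud derivative of the extremal function *)

Section Marchaud_extremal.
Context {R : realType}.
Local Notation mu := (@lebesgue_measure R).
Variables (g : R -> R) (N h k : R) (n : nat).
Hypotheses (h0 : 0 < h) (mg : measurable_fun setT g).
Hypothesis g0 : forall x, 0 <= g x.
Hypothesis gN : forall x, g x <= N.
Hypothesis gH : forall x, ~ `[0, h]%classic x -> g x = 0.
Hypotheses (k0 : 0 < k) (k1 : k < 1) (n0 : (0 < n)%N).

Let H : set R := `[0, h]%classic.
Let mH : measurable H. Proof. exact: measurable_itv. Qed.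
Let D : set R := `]0%R, +oo[%classic.
Let mD : measurable D. Proof. exact: measurable_itv. Qed.
Let Dgt0 t : D t -> 0 < t. Proof. by rewrite /D/= in_itv/= andbT. Qed.
Let kk0 : 0 < k * (1 - k). Proof. by rewrite mulr_gt0// subr_gt0. Qed.
Let q0 : 0 <= 1 - k. Proof. by rewrite subr_ge0 ltW. Qed.

Let pos (x s : R) := Num.max (s - x) 0.
Let pos_ge0 x s : 0 <= pos x s. Proof. by rewrite le_max lexx orbT. Qed.
Let mpos x (A : set R) : measurable_fun A (pos x).
Proof. by apply: measurable_maxr => //; exact: measurable_funB. Qed.

Let mgA (A : set R) : measurable_fun A g. Proof. exact: measurable_funTS. Qed.

(** Pointwise in s, (s - x)^+ - (s - x - t)^+ = min((s - x)^+, t); the additive constant drops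
    out. *)
Lemma extremal_decrement x t : 0 <= t ->
  ((extremal g h x - extremal g h (x + t))%:E =
   \int[mu]_(s in H) (Num.min (pos x s) t * g s)%:E)%E.
Proof.
move=> t0.
have im : mu.-integrable H (EFin \o (fun s => Num.min (pos x s) t * g s)).
  apply: (bounded_integrable_weight h0 mg g0 gN (c := t)).
    exact: measurable_minr.
  by move=> s _; rewrite ger0_norm ?le_min ?pos_ge0// ge_min lexx orbT.
have i1 := integrable_maxB h0 mg g0 gN x.
have i2 := integrable_maxB h0 mg g0 gN (x + t).
rewrite -[RHS]fineK; last exact: integrable_fin_num im.
congr EFin; rewrite /extremal opprB addrA subrK.
rewrite -RintegralB//; apply: eq_Rintegral => s _.
rewrite -mulrBl; congr (_ * _).
rewrite /pos; case: (leP (s - x) 0) => sx.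
  by rewrite max_r ?subr0 ?min_l//; lra.
case: (leP (s - (x + t)) 0) => sxt.
  by rewrite subr0 min_l//; lra.
by rewrite min_r//; lra.
Qed.

Lemma integral_Marchaud_extremal x :
  (\int[mu]_(t in D) ((extremal g h x - extremal g h (x + t)) / t `^ (1 + k))%:E =
   (k * (1 - k))^-1%:E * \int[mu]_(s in H) (pos x s `^ (1 - k) * g s)%:E)%E.
Proof.
pose L (t s : R) := Num.min (pos x s) t / t `^ (1 + k) * g s.
have LE t s : L t s = Num.min (pos x s) t / t `^ (1 + k) * g s by [].
have min0 s t : D t -> 0 <= Num.min (pos x s) t / t `^ (1 + k).
  by move=> /Dgt0 t0; rewrite divr_ge0 ?powR_ge0// le_min pos_ge0 ltW.
have L0 t s : D t -> H s -> 0 <= L t s.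
  by move=> Dt _; rewrite LE mulr_ge0// min0.
have mL : measurable_fun (D `*` H) (fun z : R * R => (L z.1 z.2)%:E).
  apply/measurable_EFinP; apply: measurable_funM; last by apply: measurable_fun_snd.
  under eq_fun do rewrite -powRN.
  apply: measurable_funM.
    apply: measurable_minr; first by apply: measurable_fun_snd.
    by apply: measurable_funTS; exact: measurable_fst.
  apply: (@measurable_fun_fst R D H (fun t => t `^ (- (1 + k)))) => //.
  exact: measurable_powR_in.
transitivity (\int[mu]_(t in D) \int[mu]_(s in H) (L t s)%:E)%E.
  apply: eq_integral => t /set_mem/Dgt0 t0.
  have c : 0 <= (t `^ (1 + k))^-1 by rewrite invr_ge0 powR_ge0.
  rewrite EFinM muleC (extremal_decrement x (ltW t0)).
  rewrite -ge0_integralZl_real; last 4 first.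
  - exact: mH.
  - by apply: measurable_funM => //; exact: measurable_minr.
  - by move=> s _; rewrite mulr_ge0// le_min pos_ge0 ltW.
  - exact: c.
  by apply: eq_integral => s _; rewrite LE; congr EFin; ring.
rewrite (@ge0_tonelli_in R D H (fun t s => (L t s)%:E) mD mH mL L0).
rewrite -ge0_integralZl_real; last 4 first.
- exact: mH.
- apply: measurable_funM => //.
  by apply: (measurableT_comp (measurable_powR (1 - k))).
- by move=> s _; rewrite mulr_ge0// powR_ge0.
- by rewrite invr_ge0 ltW.
apply: eq_integral => s _.
transitivity (\int[mu]_(t in D) (g s * (Num.min (pos x s) t / t `^ (1 + k)))%:E)%E.
  by apply: eq_integral => t _; rewrite LE mulrC.
rewrite ge0_integralZl_real; last 4 first.
- exact: mD.
- by apply: measurable_div_powR; exact: measurable_minr.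
- exact: min0.
- exact: g0.
rewrite (integral_min_powR k0 k1 (pos_ge0 x s)) -EFinM; congr EFin.
by field; rewrite !gt_eqF// subr_gt0.
Qed.

Lemma integrable_pow_pos x : Rp x ->
  mu.-integrable H (EFin \o (fun s => pos x s `^ (1 - k) * g s)).
Proof.
rewrite RpE => x0.
apply: (bounded_integrable_weight h0 mg g0 gN (c := h `^ (1 - k))).
  by apply: (measurableT_comp (measurable_powR (1 - k))).
move=> s; rewrite /H/= in_itv/= => /andP[s0 sh].
rewrite ger0_norm ?powR_ge0//; apply: ge0_ler_powR => //; rewrite ?nnegrE ?pos_ge0 ?(ltW h0)//.
by rewrite ge_max (ltW h0) andbT; lra.
Qed.

(** Write (u + v)^p = u (u + v)^(p - 1) + v (u + v)^(p - 1) and use that w^(p - 1) is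
    nonincreasing. *)
Lemma subadditive_powR (p u v : R) : 0 < p -> p <= 1 -> 0 <= u -> 0 <= v ->
  (u + v) `^ p <= u `^ p + v `^ p.
Proof.
move=> p0 p1; rewrite le_eqVlt => /predU1P[<-|u0].
  by rewrite add0r powR0 ?gt_eqF// add0r.
rewrite le_eqVlt => /predU1P[<-|v0].
  by rewrite addr0 [0 `^ p]powR0 ?gt_eqF// addr0.
have uv0 : 0 < u + v by exact: addr_gt0.
have E w : 0 < w -> w `^ p = w * w `^ (p - 1).
  move=> w0; rewrite -[X in X * _](powRr1 (ltW w0)) -powRD ?(gt_eqF w0) ?implybT//.
  by congr powR; ring.
have dec w : 0 < w -> w <= u + v -> (u + v) `^ (p - 1) <= w `^ (p - 1).
  move=> w0 wuv; rewrite -[p - 1]opprB !powRN lef_pV2 ?posrE ?powR_gt0//.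
  by apply: ge0_ler_powR; rewrite ?nnegrE ?subr_ge0// ltW.
rewrite !E// mulrDl; apply: lerD; rewrite ler_pM2l//; apply: dec => //.
  by rewrite lerDl ltW.
by rewrite lerDr ltW.
Qed.

Lemma integrable_tau_g : mu.-integrable H (EFin \o (fun s => tau k h s * g s)).
Proof.
apply: (bounded_integrable_weight h0 mg g0 gN (c := h `^ (1 - k))).
  exact: measurable_tau.
move=> s; rewrite /H/= in_itv/= => /andP[s0 sh].
rewrite ger0_norm; last exact: tau_ge0.
rewrite tauE// lerBlDr (@le_trans _ _ (h `^ (1 - k)))//.
  by apply: ge0_ler_powR => //; rewrite nnegrE// ltW.
by rewrite lerDl mulr_ge0// powR_ge0.
Qed.

(** Subadditivity gives s^(1 - k) <= ((s - x)^+)^(1 - k) + x^(1 - k), and s^(1 - k) = tau_h(s) +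
    h^(- k) s on [0, h]. Since ||f||_oo <= [moment] / 2, the term h^(- k) [moment] is at least 2
    h^(- k) ||f||_oo. *)
Lemma Marchaud_extremal_lower x : Rp x ->
  ((((\int[mu]_(s in H) (tau k h s * g s)) + h `^ (- k) * moment g h
     - x `^ (1 - k) * mass g h) / Gamma (2 - k))%:E
   <= Marchaud k n (extremal g h) x)%E.
Proof.
move=> Rx; have x0 : 0 <= x by rewrite -RpE.
have [G0 _] := Gamma_spec k0 k1.
have ip := integrable_pow_pos Rx.
have pfin : (\int[mu]_(s in H) (pos x s `^ (1 - k) * g s)%:E)%E \is a fin_num.
  exact: integrable_fin_num ip.
set P := (\int[mu]_(s in H) (pos x s `^ (1 - k) * g s)).
have PE : (\int[mu]_(s in H) (pos x s `^ (1 - k) * g s)%:E = P%:E)%E.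
  by rewrite -(fineK pfin).
have IE := integral_Marchaud_extremal x; rewrite PE -EFinM in IE.
have mu_ : measurable_fun D (fun t => (extremal g h x - extremal g h (x + t)) / t `^ (1 + k)).
  apply: measurable_div_powR; apply: measurable_funB => //.
  have me := measurable_extremal h0 mg g0 gN gH (D := setT).
  apply: measurable_funTS; apply: (measurableT_comp me).
  exact: measurable_funD.
have iu : mu.-integrable D (fun t => ((extremal g h x - extremal g h (x + t)) / t `^ (1 + k))%:E).
  apply/integrableP; split; first exact/measurable_EFinP.
  rewrite (_ : \int[mu]_(t in D) _ = ((k * (1 - k))^-1 * P)%:E)%E ?ltry//.
  rewrite -IE; apply: eq_integral => t /set_mem/Dgt0 t0.
  rewrite /= ger0_norm// divr_ge0 ?powR_ge0//.
  rewrite -lee_fin (extremal_decrement x (ltW t0)); apply: integral_ge0 => s _.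
  by rewrite lee_fin mulr_ge0// le_min pos_ge0 ltW.
rewrite (MarchaudE k0 k1 n0 iu) IE -EFinM lee_fin.
have -> : k * (1 - k) / Gamma (2 - k) * ((k * (1 - k))^-1 * P) = P / Gamma (2 - k).
  by field; rewrite !gt_eqF// subr_gt0.
rewrite ler_pM2r ?invr_gt0//.
have itau := integrable_tau_g.
have im := integrable_id_g h0 mg g0 gN.
have i1 : mu.-integrable H (EFin \o (fun s => 1 * g s)).
  by apply: (bounded_integrable_weight h0 mg g0 gN (c := 1)) => // s _; rewrite normr1.
have iZ (c : R) (F : R -> R) : mu.-integrable H (EFin \o F) ->
    mu.-integrable H (EFin \o (fun s => c * F s)).
  move=> iF; under [X in integrable _ _ X]eq_fun do rewrite /= EFinM.
  exact: integrableZl.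
have iD (F1 F2 : R -> R) : mu.-integrable H (EFin \o F1) ->
    mu.-integrable H (EFin \o F2) -> mu.-integrable H (EFin \o (fun s => F1 s + F2 s)).
  move=> iF1 iF2; under [X in integrable _ _ X]eq_fun do rewrite /= EFinD.
  exact: integrableD.
have im' := iZ (h `^ (- k)) _ im; have i1' := iZ (x `^ (1 - k)) _ i1.
rewrite lerBlDr /moment /mass -RintegralZl// -RintegralZl// -RintegralD// -RintegralD//.
apply: le_Rintegral => //; [exact: iD|exact: iD|].
move=> s; rewrite /H/= in_itv/= => /andP[s0 sh].
rewrite mul1r !mulrA -!mulrDl ler_wpM2r// tauE// subrK.
rewrite /pos; case: (leP (s - x) 0) => sx.
  rewrite powR0 ?subr_eq0 ?gt_eqF// add0r; apply: ge0_ler_powR => //.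
  by rewrite -subr_le0.
rewrite -[X in X `^ _ <= _](subrK x); apply: subadditive_powR => //.
- by rewrite subr_gt0.
- by rewrite gerBl ltW.
- exact: ltW.
Qed.

End Marchaud_extremal.

(** * Bounded functions in the unit ball of E, supported in [0, h] *)

Section truncation.
Context {R : realType}.
Local Notation mu := (@lebesgue_measure R).
Variables (E : idealLattice R) (u : R -> R) (h : R).
Hypothesis Eu : lat_set E u.

Let H : set R := `[0, h]%classic.
Let mH : measurable H. Proof. exact: measurable_itv. Qed.
Let HRp : H `<=` Rp.
Proof. by move=> x; rewrite RpE /H/= in_itv/= => /andP[]. Qed.

Definition truncation (m : nat) : R -> R :=
  (fun x => Num.min `|u x| m%:R) \_ H.

Lemma truncationE m x : H x -> truncation m x = Num.min `|u x| m%:R.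
Proof. by move=> Hx; rewrite /truncation patchE mem_set. Qed.

Lemma truncation_out m x : ~ H x -> truncation m x = 0.
Proof. by move=> Hx; rewrite /truncation patchE memNset. Qed.

Lemma truncation_ge0 m x : 0 <= truncation m x.
Proof.
have [Hx|Hx] := pselect (H x); last by rewrite truncation_out.
by rewrite truncationE// le_min normr_ge0 ler0n.
Qed.

Lemma truncation_le m x : truncation m x <= m%:R.
Proof.
have [Hx|Hx] := pselect (H x); last by rewrite truncation_out// ler0n.
by rewrite truncationE// ge_min lexx orbT.
Qed.

Lemma truncation_le_abs m x : truncation m x <= `|u x|.
Proof.
have [Hx|Hx] := pselect (H x); last by rewrite truncation_out.
by rewrite truncationE// ge_min lexx.
Qed.

Lemma measurable_truncation m : measurable_fun setT (truncation m).
Proof.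
apply/(measurable_restrictT _ _).1; first exact: mH.
apply: measurable_minr => //.
apply: measurableT_comp => //.
exact: measurable_funS measurable_Rp HRp (lat_measurable Eu).
Qed.

Lemma lat_truncation m :
  lat_set E (truncation m) /\ lat_norm E (truncation m) <= lat_norm E u.
Proof.
apply: (lat_ideal Eu); first by apply: measurable_funTS; exact: measurable_truncation.
by apply: aeW => x _; rewrite ger0_norm ?truncation_ge0// truncation_le_abs.
Qed.

(** The truncations increase to |u| on [0, h], so their weighted integrals converge to that of |u|
    and cannot all stay below c. *)
Lemma truncation_approx (w : R -> R) (c : R) : measurable_fun H w ->
  (forall x, H x -> 0 <= w x) ->
  (c%:E < \int[mu]_(x in H) (w x * `|u x|)%:E)%E ->
  exists m, (c%:E < \int[mu]_(x in H) (w x * truncation m x)%:E)%E.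
Proof.
move=> mw w0 cI; apply: contrapT => nex.
have le_c m : (\int[mu]_(x in H) (w x * truncation m x)%:E <= c%:E)%E.
  by rewrite leNgt; apply/negP => cm; apply: nex; exists m.
move: cI; rewrite ltNge => /negP; apply.
have mt m : measurable_fun H (fun x => (w x * truncation m x)%:E).
  apply/measurable_EFinP; apply: measurable_funM => //.
  by apply: measurable_funTS; exact: measurable_truncation.
have := @cvg_monotone_convergence _ (measurableTypeR R) _ mu H mH
  (fun m x => (w x * truncation m x)%:E) mt.
have t0 m x : H x -> (0 <= (w x * truncation m x)%:E)%E.
  by move=> Hx; rewrite lee_fin mulr_ge0// ?w0// truncation_ge0.
have nd x : H x -> nondecreasing_seq (fun m => (w x * truncation m x)%:E).
  move=> Hx m1 m2 m12; rewrite lee_fin ler_wpM2l ?w0// !truncationE//.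
  by rewrite le_min ge_min lexx/= ge_min ler_nat m12 orbT.
move=> /(_ t0 nd) cv.
have -> : (\int[mu]_(x in H) (w x * `|u x|)%:E =
   \int[mu]_(x in H) limn (fun m => (w x * truncation m x)%:E))%E.
  apply: eq_integral => x /set_mem Hx; apply/esym/cvg_lim => //.
  (* At each point the truncations are constant as soon as m exceeds |u x|. *)
  apply: cvg_near_cst; exists (Num.truncn `|u x|).+1 => // m /= um.
  rewrite truncationE// min_l//.
  by apply: ltW; apply: lt_le_trans (truncnS_gt _) _; rewrite ler_nat.
rewrite -(cvg_lim _ cv)//.
by apply: lime_le; [apply: cvgP cv|apply: nearW].
Qed.

End truncation.

(** * Near-equality for the extremal function *)

Section sharpness.
Context {R : realType}.
Local Notation mu := (@lebesgue_measure R).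
Variables (E : idealLattice R) (k h : R) (n : nat).
Hypotheses (k0 : 0 < k) (k1 : k < 1) (n0 : (0 < n)%N) (h0 : 0 < h).

Let H : set R := `[0, h]%classic.
Let G : R := Gamma (2 - k).

Lemma Marchaud_sharp (T e : R) : assoc_norm E (tau k h) = T%:E ->
  0 < e -> e < T / G ->
  exists f f2 : R -> R, L2infE E f f2 /\
   ((2 * h `^ (- k) / G)%:E * Linf_norm (EFin \o f) +
     ((T / G)%:E - e%:E) * (lat_norm E f2)%:E < Linf_norm (Marchaud k n f))%E.
Proof.
move=> TE e0 eT.
have [G0 _] : 0 < G /\ _ := Gamma_spec k0 k1.
(* Half of the admissible loss e G is spent on approximating the supremum T, the other half on
   moving from 0 to nearby points x. *)
pose c := T - e * G / 2.
have cT : (c%:E < assoc_norm E (tau k h))%E.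
  by rewrite TE lte_fin /c ltrBlDr ltrDl divr_gt0// mulr_gt0.
have [_ [u [Eu u1] <-] cu] := ereal_sup_gt cT.
have mu_ := lat_measurable Eu.
have H_tau x : H x -> 0 <= tau k h x.
  by rewrite /H/= in_itv/= => /andP[x0 xh]; exact: tau_ge0.
have cI : (c%:E < \int[mu]_(x in H) (tau k h x * `|u x|)%:E)%E.
  apply: lt_le_trans cu _.
  apply: (@le_trans _ _ (\int[mu]_(x in Rp) `|u x * tau k h x|%:E)%E).
    apply: le_trans (lee_abs _) _; apply: le_abse_integral => //.
      exact: measurable_Rp.
    by apply/measurable_EFinP; apply: measurable_funM => //; exact: measurable_tau.
  rewrite le_eqVlt; apply/orP; left; apply/eqP.
  apply: eq_integral_support => x.
  - by move=> _ /H_tau t0; rewrite normrM (ger0_norm t0) mulrC.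
  - rewrite RpE /H/= in_itv/= => x0; rewrite x0/= => /negP; rewrite -ltNge => hx.
    by rewrite /tau ltNge (ltW hx) mulr0 normr0.
  - by rewrite RpE /H/= in_itv/= => /andP[? _] [].
have [m cm] := truncation_approx Eu (@measurable_tau R k h H) H_tau cI.
set g := truncation u h m in cm.
have [Eg ng] := lat_truncation h Eu m.
have mg := measurable_truncation h Eu m.
have g0 := truncation_ge0 u h m.
have gN := truncation_le u h m.
have gH := @truncation_out _ u h m.
have Lf := Linf_extremal h0 mg g0 gN gH.
exists (extremal g h), g; split.
  by split => //; [exact: Lf.1|exact: extremal_second_derivative h0 mg g0 gN gH].
pose P := \int[mu]_(s in H) (tau k h s * g s).
have Pc : c < P.
  have Ifin : (\int[mu]_(s in H) (tau k h s * g s)%:E)%E \is a fin_num.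
    exact: integrable_fin_num (integrable_tau_g h0 mg g0 gN k0 k1).
  by rewrite -lte_fin /P /Rintegral fineK.
pose mo := moment g h; pose ma := mass g h.
have mo0 : 0 <= mo by exact: moment_ge0.
have ma0 : 0 <= ma by exact: mass_ge0.
have low x : Rp x ->
    (((P + h `^ (- k) * mo - x `^ (1 - k) * ma) / G)%:E <= Marchaud k n (extremal g h) x)%E.
  exact: (Marchaud_extremal_lower h0 mg g0 gN gH k0 k1 n0).
have Lf2 : (Linf_norm (EFin \o extremal g h) <= (mo / 2)%:E)%E := Lf.2.
clearbody mo ma P.
(* The number y bounds the left-hand side of the claim, since ||f||_oo <= [mo] / 2 and ||g||_E <= 1;
   the latter needs T / G - e >= 0. *)
pose A := 2 * h `^ (- k) / G; pose y := A * (mo / 2) + (T / G - e).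
have A0 : 0 <= A by rewrite divr_ge0 ?(ltW G0)// mulr_ge0 ?powR_ge0.
have y0 : 0 <= y.
  apply: addr_ge0; last by rewrite subr_ge0 ltW.
  by apply: mulr_ge0 => //; exact: divr_ge0.
rewrite ltNge; apply/negP => H1.
have Mle : (Linf_norm (Marchaud k n (extremal g h)) <= y%:E)%E.
  apply: le_trans H1 _; rewrite /y EFinD [in leRHS]EFinM; apply: leeD.
    by apply: lee_wpmul2l => //; exact: Lf2.
  rewrite -EFinB -EFinM lee_fin ler_piMr//; last exact: le_trans ng u1.
  by rewrite subr_ge0 ltW.
have y0' : (0 <= y%:E)%E by rewrite lee_fin.
have /(Linf_normP _ y0') [Z [mZ Z0 sZ]] := Mle.
have q0 : 0 < 1 - k by rewrite subr_gt0.
(* If x^(1 - k) <= r then x^(1 - k) [ma] <= e G / 2; adding 1 avoids dividing by a zero mass. *)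
pose r := e * G / (2 * (ma + 1)).
have r0 : 0 < r by rewrite divr_gt0// mulr_gt0// ltr_wpDl.
pose d := r `^ (1 - k)^-1.
have d0 : 0 < d by exact: powR_gt0.
have dr : d `^ (1 - k) = r.
  by rewrite -powRrM mulVf ?gt_eqF// powRr1// ltW.
(* At every x in (0, d) the lower bound for D^k f exceeds y, so (0, d) would lie in the null set
   where the essential bound fails. *)
have sub : `]0, d[%classic `<=` Z.
  move=> x /=; rewrite in_itv/= => /andP[x0 xd]; apply: sZ => /= Hx.
  have Rx : Rp x by rewrite RpE ltW.
  have xr : x `^ (1 - k) <= r.
    by rewrite -dr; apply: ge0_ler_powR; rewrite ?nnegrE ltW.
  have B : (((P + h `^ (- k) * mo - x `^ (1 - k) * ma) / G)%:E <= y%:E)%E.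
    apply: le_trans (low x Rx) _; apply: le_trans (lee_abs _) _.
    exact: Hx.
  move: B; rewrite lee_fin ler_pdivrMr// leNgt => /negP; apply.
  have -> : y * G = h `^ (- k) * mo + T - e * G.
    by rewrite /y /A; field; rewrite gt_eqF.
  have m1 : x `^ (1 - k) * ma <= e * G / 2.
    apply: (@le_trans _ _ (r * (ma + 1))).
      by apply: ler_pM => //; [exact: powR_ge0|rewrite lerDl].
    by rewrite le_eqVlt; apply/orP; left; apply/eqP; rewrite /r; field; rewrite gt_eqF// ltr_wpDl.
  move: Pc m1; rewrite /c; move: (x `^ _ * ma) (h `^ _ * mo) (e * G) => a1 a2 a3.
  lra.
have : (mu (`]0%R, d[%classic : set R) <= mu Z)%E.
  by apply: le_measure; rewrite ?inE.
rewrite Z0 lebesgue_measure_itv/= lte_fin d0 -EFinB subr0.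
by rewrite lee_fin leNgt d0.
Qed.

End sharpness.

Theorem corollary7 (R : realType) (k : R) (n : nat) (E : idealLattice R)
    (k_gt0 : 0 < k) (k_lt1 : k < 1) (k_lt_n : k < n%:R)
    (E_shift : semi_shift_invariant E)
    (E1_pow : assoc_space E (fun x : R => x `^ (1 - k) * \1_(`]0, 1[) x))
    (E1_lim : assoc_norm E (fun x : R => x `^ (1 - k) * \1_(`]0, h[) x)
                @[h --> (0 : R)^'+] --> 0%E)
    (h : R) (h_gt0 : 0 < h) :
  let A : R := 2 * h `^ (- k) / Gamma (2 - k) in
  let B : \bar R := (assoc_norm E (tau k h) * ((Gamma (2 - k))^-1)%:E)%E in
  (forall f f2 : R -> R, L2infE E f f2 ->
     (Linf_norm (Marchaud k n f) <=
        A%:E * Linf_norm (EFin \o f) + B * (lat_norm E f2)%:E)%E) /\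
  (exists2 e0 : R, 0 < e0 & forall e : R, 0 < e -> e < e0 ->
     exists f f2 : R -> R, L2infE E f f2 /\
       (A%:E * Linf_norm (EFin \o f) + (B - e%:E) * (lat_norm E f2)%:E <
          Linf_norm (Marchaud k n f))%E).
Proof.
move=> A B.
have n_gt0 : (0 < n)%N by rewrite -(ltr0n R); exact: lt_trans k_gt0 k_lt_n.
have tau_fin := assoc_norm_tau_fin k_gt0 k_lt1 E_shift E1_pow h_gt0.
have tau_gt0 := assoc_norm_tau_gt0 k_gt0 k_lt1 E1_pow h_gt0.
have [G_gt0 _] := Gamma_spec k_gt0 k_lt1.
split; first by move=> f f2; exact: Marchaud_upper_bound.
have /fineK TE : assoc_norm E (tau k h) \is a fin_num.
  by rewrite ge0_fin_numE// assoc_norm_ge0.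
set T := fine _ in TE.
(* The threshold is the constant B itself: below it, B - e stays positive. *)
exists (T / Gamma (2 - k)); first by rewrite divr_gt0// fine_gt0// tau_gt0.
move=> e e_gt0 eT; rewrite /B -TE -EFinM.
exact: Marchaud_sharp.
Qed.
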